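(* For each integer $n\ge1$, let $G_n$ be a finite connected vertex-transitive graph on $n+1$ vertices, and let $V_n$ be its vertex set with one vertex removed. Let $K_n=P_{G_n}[V_n]$ be the restriction to $V_n^2$ of the random-walk transition matrix $P_{G_n}$ of $G_n$, let $\nu_n$ be the uniform law on $V_n$, and let $\lambda_n\in(0,\infty)$. Then the $\mathrm{ARW}(K_n,\lambda_n,\nu_n)$ chain satisfies $$t_{\mathrm{rel}}^{(n)}=\frac{2n}{n+1},\qquad t_{\mathrm{sep}}^{(n)}=n+o(n)\quad(n\to\infty),$$ and there is a separation cutoff with window $O(\sqrt n)$.
   Context: Graph notions: $P_{G}(x,y)=1/\deg(x)$ if $\{x,y\}$ is an edge of $G$ and $0$ otherwise. $G$ is vertex-transitive if for any two vertices $x,y$ there is an edge-preserving bijection of the vertex set (graph automorphism) mapping $x$ to $y$. Given a finite set $V$ and a sub-stochastic matrix $K\colon V^2\to[0,1]$ (i.e. $\sum_{y}K(x,y)\le1$) having no stochastic principal sub-matrix, a $K$-walk is the killed random walk which, when alive at $x$, jumps to $y\in V$ at rate $K(x,y)$ and is killed at rate $1-\sum_yK(x,y)$. ARW dynamics with sleeping rate $\lambda\in(0,\infty)$: a configuration is $\eta\in\{0,\mathrm s,1,2,\ldots\}^V$; the site $x$ is empty if $\eta(x)=0$, holds one sleeping particle if $\eta(x)=\mathrm s$, and holds $k\ge1$ active particles if $\eta(x)=k$. In continuous time, active particles perform independent $K$-walks (a killed particle is removed), but fall asleep at rate $\lambda$ when alone on a site; sleeping particles do not move, but become active upon contact with another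 particle. Configurations in $\{0,\mathrm s\}^V$ are stable, and from any configuration with finitely many particles the process is almost surely absorbed in a stable configuration. The $\mathrm{ARW}(K,\lambda,\nu)$ chain is the discrete-time Markov chain on $\mathcal X=\{0,\mathrm s\}^V$ which at each step adds one active particle to the current state at an independent $\nu$-distributed random site and then runs the ARW dynamics until a stable configuration is obtained; the latter is the new state. Its transition matrix $P$ is irreducible and aperiodic, with unique invariant distribution $\pi$. $t_{\mathrm{rel}}:=\frac1{1-\rho}$ with $\rho:=\max\{|z|\colon z\in\mathbb C\setminus\{1\}\text{ is an eigenvalue of }P\}$; $d_{\mathrm{sep}}(t):=\max_{\eta,\eta'\in\mathcal X}\big(1-\frac{P^t(\eta,\eta')}{\pi(\eta')}\big)$; $t_{\mathrm{sep}}(\varepsilon):=\inf\{t\in\mathbb N\colon d_{\mathrm{sep}}(t)\le\varepsilon\}$, $t_{\mathrm{sep}}:=t_{\mathrm{sep}}(1/2)$, with $\mathbb N=\{0,1,2,\dots\}$. Quantities of the $n$-th chain carry the superscript $(n)$. A sequence of chains exhibits separation cutoff if for any fixed $\alpha\ge0$, $d_{\mathrm{sep}}^{(n)}(\lfloor\alpha t_{\mathrm{sep}}^{(n)}\rfloor)$ tends to $1$ if $\alpha<1$ and to $0$ if $\alpha>1$. The cutoff has window $O(w_n)$ if moreover, for every fixed $\varepsilon\in(0,1/2)$, $t_{\mathrm{sep}}^{(n)}(\varepsilon)-t_{\mathrm{sep}}^{(n)}(1-\varepsilon)=O(w_n)$. *)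

(* Defs.v *)
From HB Require Import structures.
From mathcomp Require Import all_boot all_order all_algebra.
From mathcomp Require Import perm.
From mathcomp Require Import all_classical all_reals all_analysis.
From mathcomp Require Import complex.

Set Implicit Arguments.
Unset Strict Implicit.
Unset Printing Implicit Defensive.

Import Order.TTheory GRing.Theory Num.Theory.
Import numFieldNormedType.Exports.

Local Open Scope classical_set_scope.
Local Open Scope ring_scope.

Section Graphs.
Variable T : finType.
Implicit Type e : rel T.

Definition simple_graph e := symmetric e /\ irreflexive e.

Definition connected_graph e := forall x y : T, connect e x y.

Definition vertex_transitive e :=
  forall x y : T, exists s : {perm T},
    (forall u v : T, e (s u) (s v) = e u v) /\ s x = y.

Definition walk_matrix (R : realType) e (x y : T) : R :=
  if e x y then (#|e x|%:R)^-1 else 0.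

Definition punctured (o : T) : finType := {x : T | x != o}.

End Graphs.

Definition killed_walk (R : realType) (T : finType) (e : rel T) (o : T)
    (x y : punctured o) : R :=
  walk_matrix R e (sval x) (sval y).

Definition uniform_law (R : realType) (V : finType) : V -> R :=
  fun=> (#|V|%:R)^-1.

Arguments killed_walk R {T} e o x y.
Arguments uniform_law R V : clear implicits.

Section ARW.
Variables (R : realType) (V : finType).
Variables (K : V -> V -> R) (lambda : R) (nu : V -> R).

(* [None] is a site holding one sleeping particle, [Some k] a site holding
   [k] active particles; in particular [Some 0] is an empty site. *)
Definition config := {ffun V -> option nat}.
Implicit Type eta : config.

Definition set_site eta (x : V) (v : option nat) : config :=
  [ffun z => if z == x then v else eta z].

Definition nb_active eta (x : V) : nat := odflt 0%N (eta x).

(* A particle arriving on a sleeping one wakes it up. *)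
Definition add_active eta (x : V) : config :=
  set_site eta x (Some (if eta x is Some k then k.+1 else 2%N)).

(* Only used at sites with at least one active particle. *)
Definition remove_active eta (x : V) : config :=
  set_site eta x (Some (nb_active eta x).-1).

Definition generator (f : config -> R) : config -> R := fun eta =>
  \sum_(x : V)
    ((nb_active eta x)%:R *
       (\sum_(y : V) K x y * (f (add_active (remove_active eta x) y) - f eta)
        + (1 - \sum_(y : V) K x y) * (f (remove_active eta x) - f eta))
     + (if eta x == Some 1%N then lambda * (f (set_site eta x None) - f eta)
        else 0)).

(* The Markov semigroup [exp (t * generator)], as a pointwise power series.
   The particle number never increases, so that only finitely many
   configurations can be reached from [eta]: the series is that of the
   exponential of a finite matrix, and converges. *)
Definition semigroup (t : R) (f : config -> R) (eta : config) : R :=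
  limn (series (fun k => t ^+ k / k`!%:R * iter k generator f eta)).

(* A stable configuration, encoded by its set of sleeping particles. *)
Definition stable := {ffun V -> bool}.

Definition of_stable (s : stable) : config :=
  [ffun x => if s x then None else Some 0%N].

(* The probability that the dynamics started from [eta] are absorbed in [s]:
   the limit, as t grows, of the probability to be in [s] at time t. *)
Definition stabilize_prob eta (s : stable) : R :=
  lim (semigroup t (fun xi => (xi == of_stable s)%:R) eta @[t --> +oo]).

Definition ARW_step (s s' : stable) : R :=
  \sum_(x : V) nu x * stabilize_prob (add_active (of_stable s) x) s'.

Definition ARW : 'M[R]_#|stable| :=
  \matrix_(i, j) ARW_step (enum_val i) (enum_val j).

End ARW.

Section MarkovChain.
Variables (R : realType) (m : nat) (P : 'M[R]_m).

Definition invariant_law (pi : 'rV[R]_m) : Prop :=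
  [/\ forall i, 0 <= pi 0 i, \sum_i pi 0 i = 1 & pi *m P = pi].

(* The invariant law, for chains having exactly one. *)
Definition stationary : 'rV[R]_m := xget 0 [set pi | invariant_law pi].

(* A supremum over finitely many values, hence a maximum. *)
Definition spectral_radius_off1 : R :=
  sup [set ComplexField.Normc.normc z | z in
         [set z : R[i] | eigenvalue (map_mx (real_complex R) P) z /\ z != 1]].

Definition t_rel : R := (1 - spectral_radius_off1)^-1.

(* A supremum over finitely many values, hence a maximum. *)
Definition d_sep (t : nat) : R :=
  sup [set 1 - (P ^+ t) ij.1 ij.2 / stationary 0 ij.2
      | ij in [set: 'I_m * 'I_m]].

Definition t_sep_at (eps : R) : R :=
  inf [set t%:R | t in [set t : nat | d_sep t <= eps]].

Definition t_sep : R := t_sep_at 2^-1.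

End MarkovChain.

Section Cutoff.
Variables (R : realType) (m : nat -> nat) (P : forall n, 'M[R]_(m n)).

Definition separation_cutoff :=
  forall alpha : R, 0 <= alpha ->
    (alpha < 1 ->
       d_sep (P n) (Num.truncn (alpha * t_sep (P n))) @[n --> \oo] --> (1 : R))
    /\
    (1 < alpha ->
       d_sep (P n) (Num.truncn (alpha * t_sep (P n))) @[n --> \oo] --> (0 : R)).

Definition separation_cutoff_window (w : nat -> R) :=
  separation_cutoff /\
  forall eps : R, 0 < eps -> eps < 2^-1 ->
    (fun n => t_sep_at (P n) eps - t_sep_at (P n) (1 - eps)) =O_\oo w.

End Cutoff.

(* Main.v *)
(* Let a walk started at a uniform site settle at the first vacant site it
   visits (internal DLA), and let tau be the time at which V is full.  By the
   abelian property, the particles added to the ARW chain may first perform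
   internal DLA and be stabilized afterwards; once every site holds an active
   particle, the stabilized law is the invariant one, whatever else was added.
   This intertwines the ARW chain with internal DLA, whose transition matrix is
   triangular, so that the ARW eigenvalues are among the probabilities
   [loss A] that a walk is killed before leaving A, and d_sep(t) = P(tau > t):
   the full configuration cannot be reached from the empty one before tau.

   [loss A] increases with A, so that it remains to compute it when A misses a
   single site w.  By reversibility and transitivity, the hitting times of w
   from the root and of the root from w agree, which gives (n-1)/2n.

   For the cutoff, internal DLA is abelian too: filling one more site at the
   start decreases E tau by at most 2, so that Var tau = O(E tau).  Finally,
   E tau = n + o(n): for each site z, the sum over the vacant sites y of the
   probability that a walk from y visits z, plus the number of steps times its
   drift, is a martingale until z is filled; its fluctuations have order sqrt n,
   hence z is unlikely to be vacant at a time n + t with t much larger than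
   sqrt n. *)
Require Import Defs.
From mathcomp Require Import all_boot all_order all_algebra.
From mathcomp Require Import all_classical all_reals all_analysis.
From mathcomp Require Import perm complex.
From mathcomp Require Import ring lra zify.

Set Implicit Arguments.
Unset Strict Implicit.
Unset Printing Implicit Defensive.

Import Order.TTheory GRing.Theory Num.Theory.
Import numFieldNormedType.Exports.

Local Open Scope classical_set_scope.
Local Open Scope ring_scope.

(** There is no probability space: a law is the operator sending a test function to its expectation.
    Abelian properties become commutations of such operators, and tau is present only through
    [filled t], the probability that tau <= t, and through a function [u] on sets, the expected time
    left until V is full. Identities hold because both sides solve the same linear problem,
    inequalities by maximum principles.

    The chain is defined by the limit of a semigroup in continuous time, while the abelian property
    is about discrete topplings. The bridge is harmonicity: [stab], obtained by toppling, and the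
    limit of the uniformized chain are both in the kernel of [generator] and agree on stable
    configurations. Bounding the number of particles makes the state space finite, and there these
    two properties determine a function.

    That the loss with one vacant site is at most 1/2 is used quantitatively: a walk fills the last
    vacancy with probability at least 1/2, which is where the bound 2 on the time saved by one
    filled site comes from. *)

Lemma sum_option (R : nmodType) (I : finType) (F : option I -> R) :
  \sum_(i : option I) F i = F None + \sum_(i : I) F (Some i).
Proof.
rewrite (bigD1 None) //=; congr (_ + _).
rewrite (reindex_omap Some id) /=; last by case.
by apply: eq_bigl => i; rewrite eqxx.
Qed.

(** * Configurations and the commutation of moves *)

Section Configurations.
Variable V : finType.
Implicit Types (eta : config V) (x y z : V) (v : option nat).

Definition active eta x := (0 < nb_active eta x)%N.

Definition stableb eta := [forall x, ~~ active eta x].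

(** Without effect unless the particle is alone, so that every active site has the same total
    toppling rate [1 + lambda]. *)
Definition try_sleep eta x : config V :=
  if eta x == Some 1%N then set_site eta x None else eta.

Definition particles eta : nat := (\sum_x odflt 1 (eta x))%N.

(** Every move is composed of maps acting on the content of one site; commutation is then to be
    checked in [option nat], and only when the two sites coincide. *)
Definition update (g : option nat -> option nat) x eta : config V :=
  [ffun z => if z == x then g (eta z) else eta z].

Lemma update_comm g h x y eta : (x = y -> g (h (eta x)) = h (g (eta x))) ->
  update g x (update h y eta) = update h y (update g x eta).
Proof.
move=> gh; apply/ffunP => z; rewrite !ffunE.
have [zx|zx] := eqVneq z x; have [zy|zy] := eqVneq z y => //.
by rewrite zx gh // -zx.
Qed.

Definition add1 v := Some (if v is Some k then k.+1 else 2%N).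
Definition remove1 v := Some (odflt 0%N v).-1.
Definition sleep1 v := if v == Some 1%N then None else v.

Lemma add_activeE eta x : add_active eta x = update add1 x eta.
Proof. by apply/ffunP => z; rewrite !ffunE; case: eqP => // ->. Qed.

Lemma remove_activeE eta x : remove_active eta x = update remove1 x eta.
Proof. by apply/ffunP => z; rewrite !ffunE; case: eqP => // ->. Qed.

Lemma try_sleepE eta x : try_sleep eta x = update sleep1 x eta.
Proof.
apply/ffunP => z; rewrite /try_sleep !ffunE.
case: (eqVneq z x) => [->|zx]; rewrite /sleep1; case: eqP => // _; rewrite ffunE ?eqxx //.
by rewrite (negPf zx).
Qed.

Definition opE := (add_activeE, remove_activeE, try_sleepE).

Lemma add_activeC eta x y :
  add_active (add_active eta x) y = add_active (add_active eta y) x.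
Proof. by rewrite !opE update_comm // => ->. Qed.

(* [None]: attempt to fall asleep, [Some None]: be killed, [Some (Some y)]:
   jump to [y]. *)
Definition move := option (option V).

Definition apply_move x (m : move) eta : config V :=
  match m with
  | None => try_sleep eta x
  | Some None => remove_active eta x
  | Some (Some y) => add_active (remove_active eta x) y
  end.

Lemma active_cases eta x : active eta x -> exists k, eta x = Some k.+1.
Proof. by rewrite /active /nb_active; case: (eta x) => [[|k]|] //= _; exists k. Qed.

Lemma nb_active_update g x y eta : x != y ->
  nb_active (update g x eta) y = nb_active eta y.
Proof. by move=> xy; rewrite /nb_active ffunE eq_sym (negPf xy). Qed.

Lemma active_add eta x y : active eta x -> active (add_active eta y) x.
Proof.
move=> ax; rewrite opE; have [->|yx] := eqVneq y x; last by rewrite /active nb_active_update.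
by rewrite /active /nb_active ffunE eqxx; case: (eta x).
Qed.

Lemma active_add_self eta x : active (add_active eta x) x.
Proof. by rewrite opE /active /nb_active ffunE eqxx; case: (eta x). Qed.

Lemma active_apply_move eta x y m : x != y -> active eta x ->
  active (apply_move y m eta) x.
Proof.
move=> xy ax; have yx : y != x by rewrite eq_sym.
case: m => [[z|]|] /=; first apply: active_add.
all: by rewrite !opE /active nb_active_update.
Qed.

(** The delicate case is an attempt to sleep at [x = z] with one particle: once asleep it is woken
    by the newcomer, and in its presence it cannot fall asleep. Both orders give two active
    particles. *)
Lemma apply_move_add eta x z m : active eta x ->
  apply_move x m (add_active eta z) = add_active (apply_move x m eta) z.
Proof.
case/active_cases => k ek.
have rem : remove_active (add_active eta z) x = add_active (remove_active eta x) z.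
  by rewrite !opE update_comm // => _; rewrite ek.
case: m => [[y|]|] /=; rewrite ?rem //; first by rewrite add_activeC.
by rewrite !opE update_comm // => _; rewrite ek /sleep1 /=; case: k ek.
Qed.

Lemma apply_moveC eta x y m m' : x != y -> active eta x -> active eta y ->
  apply_move x m (apply_move y m' eta) = apply_move y m' (apply_move x m eta).
Proof.
move=> xy ax ay.
have remC g h xi : update g x (update h y xi) = update h y (update g x xi).
  by apply: update_comm => exy; rewrite exy eqxx in xy.
case: m m' => [[u|]|] [[w|]|]; rewrite /apply_move.
- have ryx := @active_apply_move eta x y (Some None) xy ax.
  have rxy := @active_apply_move eta y x (Some None).
  rewrite eq_sym in rxy; move: {rxy}(rxy xy ay) => rxy.
  have := @apply_move_add _ x w (Some None) ryx; rewrite /= => ->.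
  have := @apply_move_add _ y u (Some None) rxy; rewrite /= => ->.
  by rewrite add_activeC !(remove_activeE _ x) !(remove_activeE _ y) remC.
- have rxy := @active_apply_move eta y x (Some None).
  rewrite eq_sym in rxy; move: {rxy}(rxy xy ay) => rxy.
  have := @apply_move_add _ y u (Some None) rxy; rewrite /= => ->.
  by rewrite !(remove_activeE _ x) !(remove_activeE _ y) remC.
- have rxy := @active_apply_move eta y x (Some None).
  rewrite eq_sym in rxy; move: {rxy}(rxy xy ay) => rxy.
  have := @apply_move_add _ y u None rxy; rewrite /= => ->.
  by rewrite !(remove_activeE _ x) !(try_sleepE _ y) remC.
- have ryx := @active_apply_move eta x y (Some None) xy ax.
  have := @apply_move_add _ x w (Some None) ryx; rewrite /= => ->.
  by rewrite !(remove_activeE _ x) !(remove_activeE _ y) remC.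
- by rewrite !opE remC.
- by rewrite !opE remC.
- have ryx := @active_apply_move eta x y (Some None) xy ax.
  have := @apply_move_add _ x w None ryx; rewrite /= => ->.
  by rewrite !(remove_activeE _ y) !(try_sleepE _ x) remC.
- by rewrite !opE remC.
- by rewrite !opE remC.
Qed.

Lemma particles_update g x eta :
  (particles (update g x eta) + odflt 1 (eta x) =
   particles eta + odflt 1 (g (eta x)))%N.
Proof.
rewrite /particles (bigD1 x) //= [in RHS](bigD1 x) //= ffunE eqxx.
rewrite (eq_bigr (fun z => odflt 1%N (eta z))); last first.
  by move=> z zx; rewrite ffunE (negPf zx).
lia.
Qed.

Lemma particles_add eta x : particles (add_active eta x) = (particles eta).+1.
Proof.
have := particles_update add1 x eta; rewrite -add_activeE.
case: (eta x) => [k|] /=; first by rewrite addnS -addSn => /addIn.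
by rewrite addn1 addn2 => -[].
Qed.

Lemma particles_remove eta x : active eta x ->
  (particles (remove_active eta x)).+1 = particles eta.
Proof.
case/active_cases => k ek; have := particles_update remove1 x eta.
by rewrite -remove_activeE ek /= addnS -addSn => /addIn.
Qed.

Lemma particles_sleep eta x : particles (try_sleep eta x) = particles eta.
Proof.
have := particles_update sleep1 x eta; rewrite -try_sleepE /sleep1.
by case: eqP => [->|_] /= => [|/addIn//]; apply: addIn.
Qed.

Lemma particles_apply_move eta x m : active eta x ->
  (particles (apply_move x m eta) <= particles eta)%N.
Proof.
move=> ax; case: m => [[y|]|] /=; last by rewrite particles_sleep.
  by rewrite particles_add particles_remove.
by rewrite -(particles_remove ax).
Qed.

Lemma stableP eta : reflect (exists s, eta = of_stable s) (stableb eta).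
Proof.
apply: (iffP forallP) => [st|[s ->] x]; last by rewrite /active /nb_active ffunE; case: (s x).
exists [ffun x => eta x == None]; apply/ffunP => x; rewrite !ffunE.
by have := st x; rewrite /active /nb_active; case: (eta x) => [[|k]|].
Qed.

Lemma unstableP eta : reflect (exists x, active eta x) (~~ stableb eta).
Proof.
rewrite negb_forall; apply: (iffP existsP) => -[x ax]; exists x; first by rewrite negbK in ax.
by rewrite negbK.
Qed.

Lemma stable_of_stable (s : stable V) : stableb (of_stable s).
Proof. by apply/stableP; exists s. Qed.

Lemma of_stable_inj : injective (@of_stable V).
Proof.
move=> s s' /ffunP e; apply/ffunP => x; have := e x; rewrite !ffunE.
by case: (s x); case: (s' x).
Qed.

End Configurations.

Lemma cvg_sum (R : realType) (I : finType) (u : I -> nat -> R) (l : I -> R) :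
  (forall i, u i @ \oo --> l i) -> (fun n => \sum_i u i n) @ \oo --> \sum_i l i.
Proof. by move=> ul; apply: cvg_big => //; exact: add_continuous. Qed.

Definition kill_rate (R : realType) (V : finType) (K : V -> V -> R) x := 1 - \sum_y K x y.

(* The hypothesis [killed] is an induction principle expressing that from
   every site the walk has a chance of being killed. *)
Record killed_kernel (R : realType) (V : finType) (K : V -> V -> R) : Prop := {
  kernel_ge0 : forall x y, 0 <= K x y;
  kill_rate_ge0 : forall x, 0 <= kill_rate K x;
  killed : forall D : V -> Prop, (forall x, 0 < kill_rate K x -> D x) ->
    (forall x y, 0 < K x y -> D y -> D x) -> forall x, D x }.

(** * Topplings and the law of the stabilized configuration *)

Section Toppling.
Variables (R : realType) (V : finType) (K : V -> V -> R) (lambda : R).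
Hypotheses (Kk : killed_kernel K) (lambda_gt0 : 0 < lambda).
Implicit Types (eta xi : config V) (x y z : V) (f g : config V -> R).

Definition weight x (m : move V) : R :=
  match m with
  | None => lambda
  | Some None => kill_rate K x
  | Some (Some y) => K x y
  end.

(** The total rate [1 + lambda] times the expectation of [f] after one move from [x]. *)
Definition topple x f eta : R := \sum_m weight x m * f (apply_move x m eta).

Lemma weight_ge0 x m : 0 <= weight x m.
Proof.
case: m => [[y|]|] /=; [exact: kernel_ge0 | exact: kill_rate_ge0 | exact: ltW].
Qed.

Lemma sum_weight x : \sum_m weight x m = 1 + lambda.
Proof. by rewrite !sum_option /= /kill_rate subrK addrC. Qed.

Lemma topple_ext x f g eta : (forall m, f (apply_move x m eta) = g (apply_move x m eta)) ->
  topple x f eta = topple x g eta.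
Proof. by move=> fg; apply: eq_bigr => m _; rewrite fg. Qed.

Lemma topple_cst x (c : R) eta : topple x (fun=> c) eta = (1 + lambda) * c.
Proof. by rewrite /topple -mulr_suml sum_weight. Qed.

Lemma toppleZ x (c : R) f eta : topple x (fun xi => c * f xi) eta = c * topple x f eta.
Proof. by rewrite /topple mulr_sumr; apply: eq_bigr => m _; rewrite mulrCA. Qed.

Lemma topple_sum x (I : finType) (F : I -> config V -> R) eta :
  topple x (fun xi => \sum_i F i xi) eta = \sum_i topple x (F i) eta.
Proof.
by rewrite /topple exchange_big; apply: eq_bigr => m _; rewrite mulr_sumr.
Qed.

Lemma le_topple x f g eta : (forall m, f (apply_move x m eta) <= g (apply_move x m eta)) ->
  topple x f eta <= topple x g eta.
Proof. by move=> fg; apply: ler_sum => m _; rewrite ler_wpM2l ?weight_ge0. Qed.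

Lemma topple_ge0 x f eta : (forall m, 0 <= f (apply_move x m eta)) -> 0 <= topple x f eta.
Proof. by move=> f0; apply: sumr_ge0 => m _; rewrite mulr_ge0 ?weight_ge0. Qed.

Lemma toppleC x y f eta : x != y -> active eta x -> active eta y ->
  topple x (topple y f) eta = topple y (topple x f) eta.
Proof.
move=> xy ax ay; rewrite /topple.
under eq_bigr do rewrite mulr_sumr.
rewrite exchange_big; apply: eq_bigr => m _ /=; rewrite mulr_sumr.
by apply: eq_bigr => m' _; rewrite mulrCA apply_moveC // eq_sym.
Qed.

Lemma topple_add x z f eta : active eta x ->
  topple x (fun xi => f (add_active xi z)) eta = topple x f (add_active eta z).
Proof. by move=> ax; apply: eq_bigr => m _; rewrite apply_move_add. Qed.

Lemma generatorE f eta : generator K lambda f eta =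
  \sum_x (nb_active eta x)%:R * (topple x f eta - (1 + lambda) * f eta).
Proof.
apply: eq_bigr => x _; rewrite /topple !sum_option /= /try_sleep.
rewrite (eq_bigr (fun y => K x y * f (add_active (remove_active eta x) y) - K x y * f eta)); last first.
  by move=> y _; rewrite mulrBr.
rewrite sumrB -mulr_suml /kill_rate.
by case: ifP => [/eqP e|_]; rewrite /nb_active ?e /=; ring.
Qed.

Section Stabilization.
Variable s : stable V.

(** The probability that stabilization ends in [s] after exactly [N] topplings, ineffective attempts
    to sleep included. *)
Fixpoint stab_at (N : nat) eta : R :=
  match N with
  | 0 => (eta == of_stable s)%:R
  | N'.+1 => if [pick x | active eta x] is Some x
             then (1 + lambda)^-1 * topple x (stab_at N') eta else 0
  end.

Lemma rate_gt0 : 0 < 1 + lambda. Proof. by rewrite addr_gt0. Qed.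

Lemma stab_at_stable N s' : stab_at N (of_stable s') = ((N == 0) && (s' == s))%:R.
Proof.
case: N => [|N] /=; first by rewrite (inj_eq (@of_stable_inj V)).
case: pickP => // x ax; have /stableP : exists s, of_stable s' = of_stable s :> config V by exists s'.
by move=> /forallP/(_ x); rewrite ax.
Qed.

Lemma stab_at0_active eta x : active eta x -> stab_at 0 eta = 0.
Proof.
by move=> ax /=; case: eqP => // es; have /forallP/(_ x) := stable_of_stable s; rewrite -es ax.
Qed.

(* The abelian property: the law of the stabilized configuration together with
   the number of topplings does not depend on which site topples first. *)
Lemma stab_at_topple N eta x : active eta x ->
  stab_at N.+1 eta = (1 + lambda)^-1 * topple x (stab_at N) eta.
Proof.
elim: N eta x => [|N IH] eta x ax; rewrite [LHS]/=; case: pickP => [y ay|/(_ x)]; rewrite ?ax //.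
  have [-> //|xy] := eqVneq x y; congr (_ * _).
  have z a b : a != b -> active eta a -> active eta b -> topple a (stab_at 0) eta = 0.
    move=> ab aa ab'; rewrite (topple_ext (g := fun=> 0)) ?topple_cst ?mulr0 // => m.
    by apply: (@stab_at0_active _ b); apply: active_apply_move => //; rewrite eq_sym.
  by rewrite (z y x) ?(z x y) // eq_sym.
have [-> //|xy] := eqVneq x y; congr (_ * _).
rewrite (topple_ext (g := fun xi => (1 + lambda)^-1 * topple x (stab_at N) xi)); last first.
  by move=> m; rewrite -IH //; apply: active_apply_move.
rewrite toppleZ -toppleC // -toppleZ; apply: topple_ext => m; rewrite (IH _ y) //.
by apply: active_apply_move; rewrite // eq_sym.
Qed.

Lemma stab_at_ge0 N eta : 0 <= stab_at N eta.
Proof.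
elim: N eta => [|N IH] eta /=; first by rewrite ler0n.
by case: pickP => // x _; rewrite mulr_ge0 ?topple_ge0 // invr_ge0 ltW ?rate_gt0.
Qed.

(** Moves never create particles. *)
Lemma stab_at_particles N eta : (particles eta < \sum_x s x)%N -> stab_at N eta = 0.
Proof.
elim: N eta => [|N IH] eta ps /=.
  case: eqP => // es; move: ps; rewrite es /particles.
  rewrite (eq_bigr (fun x => nat_of_bool (s x))) ?ltnn // => x _.
  by rewrite ffunE; case: (s x).
case: pickP => // x ax; rewrite (topple_ext (g := fun=> 0)) ?topple_cst ?mulr0 // => m.
by apply: IH; apply: leq_ltn_trans ps; exact: particles_apply_move.
Qed.

Lemma sum_stab_at_topple N eta x : active eta x ->
  \sum_(k < N.+1) stab_at k eta =
  (1 + lambda)^-1 * topple x (fun xi => \sum_(k < N) stab_at k xi) eta.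
Proof.
move=> ax; rewrite big_ord_recl (stab_at0_active ax) add0r topple_sum mulr_sumr.
by apply: eq_bigr => k _; rewrite (stab_at_topple _ ax).
Qed.

Lemma sum_stab_at_le1 N eta : \sum_(k < N) stab_at k eta <= 1.
Proof.
elim: N eta => [|N IH] eta; first by rewrite big_ord0.
have [/stableP[s' ->]|/unstableP[x ax]] := boolP (stableb eta).
  rewrite big_ord_recl stab_at_stable big1 => [|i _]; last by rewrite stab_at_stable.
  by rewrite addr0 lern1 leq_b1.
rewrite (sum_stab_at_topple _ ax) mulrC ler_pdivrMr ?rate_gt0 // mul1r.
by rewrite -[leRHS]mulr1 -(topple_cst x 1 eta) le_topple.
Qed.

Definition stab eta : R := limn (fun N => \sum_(k < N) stab_at k eta).

Lemma cvg_stab eta : (fun N => \sum_(k < N) stab_at k eta) @ \oo --> stab eta.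
Proof.
apply: nondecreasing_is_cvgn => [|]; last first.
  by exists 1 => _ [N _ <-]; exact: sum_stab_at_le1.
by apply/nondecreasing_seqP => N; rewrite big_ord_recr /= lerDl stab_at_ge0.
Qed.

(** First-step analysis passes to the limit at every active site, not only at the one selected by
    [pick]: this is the form in which the abelian property is used. *)
Lemma stab_topple eta x : active eta x -> topple x stab eta = (1 + lambda) * stab eta.
Proof.
move=> ax.
have c : (fun N => (1 + lambda) * \sum_(k < N) stab_at k eta) @ \oo --> topple x stab eta.
  rewrite -cvg_shiftS /=.
  under eq_fun do rewrite (sum_stab_at_topple _ ax) mulrA divff ?mul1r ?gt_eqF ?rate_gt0 //.
  by apply: cvg_sum => m; apply: cvgM; [exact: cvg_cst | exact: cvg_stab].
apply: (@cvg_unique R _ _ _ _ _ c) => //.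
by apply: cvgM; [exact: cvg_cst | exact: cvg_stab].
Qed.

Lemma stab_stable s' : stab (of_stable s') = (s' == s)%:R.
Proof.
have c : (fun N => \sum_(k < N) stab_at k (of_stable s')) @ \oo --> ((s' == s)%:R : R).
  rewrite -cvg_shiftS /=; under eq_fun.
    move=> N; rewrite big_ord_recl stab_at_stable big1 => [|i _]; last by rewrite stab_at_stable.
    rewrite addr0 /=; over.
  exact: cvg_cst.
by apply/esym; apply: (@cvg_unique R _ _ _ _ _ c) => //; exact: cvg_stab.
Qed.

Lemma stab_ge0 eta : 0 <= stab eta.
Proof.
apply: (limr_ge (cvgP _ (@cvg_stab eta))); apply: nearW => N.
by apply: sumr_ge0 => k _; exact: stab_at_ge0.
Qed.

Lemma stab_particles eta : (particles eta < \sum_x s x)%N -> stab eta = 0.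
Proof.
move=> ps; rewrite /stab; under eq_fun do (rewrite big1 => [|i _]; last exact: stab_at_particles).
exact: lim_cst.
Qed.

End Stabilization.
End Toppling.

(** * Maximum principle for the generator and harmonic extension *)

Section Uniqueness.
Variables (R : realType) (V : finType) (K : V -> V -> R) (lambda : R).
Hypotheses (Kk : killed_kernel K) (lambda_gt0 : 0 < lambda).
Implicit Types (eta xi : config V) (x y z : V) (u v : config V -> R).

(** With at most [N] particles each site has one of finitely many contents, so that a maximum over a
    finite type suffices. *)
Lemma exists_max_config N u eta0 : (particles eta0 <= N)%N ->
  exists2 M : R, (exists2 xi, (particles xi <= N)%N & u xi = M) &
                 forall eta, (particles eta <= N)%N -> u eta <= M.
Proof.
pose emb (phi : {ffun V -> option 'I_N.+1}) : config V := [ffun x => omap val (phi x)].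
have embK eta : (particles eta <= N)%N -> exists phi, emb phi = eta.
  move=> pe; exists [ffun x => omap inord (eta x)]; apply/ffunP => x; rewrite !ffunE.
  case e : (eta x) => [k|] //=; rewrite inordK // ltnS; apply: leq_trans pe.
  by rewrite /particles (bigD1 x) //= e leq_addr.
move=> p0; have [phi0 e0] := embK _ p0.
have P0 : (particles (emb phi0) <= N)%N by rewrite e0.
case: (@arg_maxP _ _ _ phi0 (fun phi => particles (emb phi) <= N)%N (u \o emb) P0).
move=> phi pphi max; exists (u (emb phi)); first by exists (emb phi).
by move=> eta peta; have [psi epsi] := embK _ peta; rewrite -epsi; apply: max; rewrite epsi.
Qed.

Lemma particles_jump eta x y : active eta x ->
  particles (add_active (remove_active eta x) y) = particles eta.
Proof. by move=> ax; rewrite particles_add particles_remove. Qed.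

(** At a maximum every term of the generator is nonpositive; their sum being zero, each vanishes,
    and the maximum is shared by all configurations reached by a move of positive rate. *)
Lemma max_config_move N u M eta x m :
  (forall xi, (particles xi <= N)%N -> u xi <= M) ->
  (particles eta <= N)%N -> u eta = M -> generator K lambda u eta = 0 -> active eta x ->
  0 < weight K lambda x m -> u (apply_move x m eta) = M.
Proof.
move=> max pe ue Gu ax wm.
have le0 y : active eta y -> topple K lambda y u eta <= (1 + lambda) * M.
  move=> ay; rewrite -(topple_cst K lambda y M eta) le_topple // => m'.
  by apply: max; apply: leq_trans pe; exact: particles_apply_move.
have eqx : topple K lambda x u eta = (1 + lambda) * M.
  apply/eqP; rewrite eq_le le0 //=.
  move/eqP: Gu; rewrite generatorE ue -oppr_eq0 -sumrN psumr_eq0 => [/allP/(_ x)|y _].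
    rewrite mem_index_enum => /(_ isT) /=; rewrite oppr_eq0 mulf_eq0 pnatr_eq0 subr_eq0.
    by rewrite /active in ax; rewrite -leqn0 leqNgt ax /= => /eqP ->.
  rewrite oppr_ge0; have [ay|] := boolP (active eta y).
    by rewrite mulr_ge0_le0 ?ler0n // subr_le0 le0.
  by rewrite /active -eqn0Ngt => /eqP ->; rewrite mul0r.
move/eqP: eqx; rewrite -(topple_cst K lambda x M eta) eq_sym -subr_eq0 /topple -sumrB.
rewrite psumr_eq0 => [/allP/(_ m)|m' _].
  rewrite mem_index_enum => /(_ isT) /=; rewrite -mulrBr mulf_eq0 gt_eqF //= subr_eq0.
  by move/eqP.
rewrite -mulrBr mulr_ge0 ?weight_ge0 // subr_ge0 max //.
by apply: leq_trans pe; exact: particles_apply_move.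
Qed.

(** A positive maximum is carried along by a single particle walking until it is killed, hence is
    attained with fewer particles. Repeating this ends at a stable configuration, where [u] is
    nonpositive. *)
Lemma generator_max N u :
  (forall eta, (particles eta <= N)%N -> generator K lambda u eta = 0) ->
  (forall s, (particles (of_stable s) <= N)%N -> u (of_stable s) <= 0) ->
  forall eta, (particles eta <= N)%N -> u eta <= 0.
Proof.
move=> Gu us eta0 p0; rewrite leNgt; apply/negP => u0.
have [M [xi0 pxi0 uxi0] max] := exists_max_config u p0.
have M0 : 0 < M by apply: lt_le_trans u0 (max _ p0).
have drop x : forall eta, (particles eta <= N)%N -> u eta = M -> active eta x ->
    exists2 xi, (particles xi < particles eta)%N & u xi = M.
  elim/(killed Kk): x => [x kx|x y Kxy IH] eta pe ue ax.
    exists (remove_active eta x); first by rewrite -(particles_remove ax).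
    exact: (max_config_move (m := Some None) max pe ue (Gu _ pe) ax).
  rewrite -(particles_jump y ax); apply: IH; rewrite ?particles_jump ?active_add_self //.
  exact: (max_config_move (m := Some (Some y)) max pe ue (Gu _ pe) ax).
have [k] := ubnP (particles xi0); elim: k xi0 pxi0 uxi0 => // k IH xi pxi uxi lxi.
have [/stableP[s es]|/unstableP[x ax]] := boolP (stableb xi).
  by have := us s; rewrite -es uxi leNgt M0 => /(_ pxi).
have [xi' p' u'] := drop x _ pxi uxi ax.
apply: (IH xi') => //; first by rewrite (leq_trans _ pxi) // ltnW.
by rewrite (leq_trans p').
Qed.

Lemma generatorB u v eta : generator K lambda (fun xi => u xi - v xi) eta =
  generator K lambda u eta - generator K lambda v eta.
Proof.
rewrite !generatorE -sumrB; apply: eq_bigr => x _.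
rewrite (_ : topple _ _ _ _ _ = topple K lambda x u eta - topple K lambda x v eta); first by ring.
by rewrite /topple -sumrB; apply: eq_bigr => m _; rewrite mulrBr.
Qed.

Lemma generator_uniq N u v :
  (forall eta, (particles eta <= N)%N -> generator K lambda u eta = 0) ->
  (forall eta, (particles eta <= N)%N -> generator K lambda v eta = 0) ->
  (forall s, (particles (of_stable s) <= N)%N -> u (of_stable s) = v (of_stable s)) ->
  forall eta, (particles eta <= N)%N -> u eta = v eta.
Proof.
move=> Gu Gv uv eta pe; apply/eqP; rewrite -subr_eq0 eq_le -[X in _ && X]oppr_le0 opprB.
apply/andP; split.
  apply: (@generator_max N (fun xi => u xi - v xi)) => // [xi px|s ps].
    by rewrite generatorB Gu // Gv // subrr.
  by rewrite uv // subrr.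
apply: (@generator_max N (fun xi => v xi - u xi)) => // [xi px|s ps].
  by rewrite generatorB Gu // Gv // subrr.
by rewrite uv // subrr.
Qed.

Lemma generator_topple (f : config V -> R) eta :
  (forall x, active eta x -> topple K lambda x f eta = (1 + lambda) * f eta) ->
  generator K lambda f eta = 0.
Proof.
move=> ft; rewrite generatorE big1 // => x _.
have [/ft ->|] := boolP (active eta x); first by rewrite subrr mulr0.
by rewrite /active -eqn0Ngt => /eqP ->; rewrite mul0r.
Qed.

Lemma topple_uniq u v :
  (forall eta x, active eta x -> topple K lambda x u eta = (1 + lambda) * u eta) ->
  (forall eta x, active eta x -> topple K lambda x v eta = (1 + lambda) * v eta) ->
  (forall s, u (of_stable s) = v (of_stable s)) -> u =1 v.
Proof.
move=> tu tv uv eta; apply: (@generator_uniq (particles eta)) => // xi _.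
  by apply: generator_topple => x /tu.
by apply: generator_topple => x /tv.
Qed.

(** The expectation of [f] at the stabilized configuration; equivalently, the harmonic extension of
    [f] from the stable configurations. *)
Definition stab_ext (f : stable V -> R) eta : R := \sum_s stab K lambda s eta * f s.

Lemma stab_ext_topple f eta x : active eta x ->
  topple K lambda x (stab_ext f) eta = (1 + lambda) * stab_ext f eta.
Proof.
move=> ax; rewrite topple_sum mulr_sumr; apply: eq_bigr => s _.
rewrite mulrA -(stab_topple Kk lambda_gt0 s ax) mulrC -toppleZ.
by apply: topple_ext => m; rewrite mulrC.
Qed.

Lemma stab_ext_stable f s : stab_ext f (of_stable s) = f s.
Proof.
rewrite /stab_ext (bigD1 s) //= stab_stable // eqxx mul1r big1 ?addr0 // => s' ss'.
by rewrite stab_stable // eq_sym (negPf ss') mul0r.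
Qed.

Lemma stab_ext_uniq f u :
  (forall eta x, active eta x -> topple K lambda x u eta = (1 + lambda) * u eta) ->
  (forall s, u (of_stable s) = f s) -> u =1 stab_ext f.
Proof.
move=> tu us; apply: topple_uniq => // [eta x|s]; first exact: stab_ext_topple.
by rewrite us stab_ext_stable.
Qed.

Lemma sum_stab eta : \sum_s stab K lambda s eta = 1.
Proof.
transitivity (stab_ext (fun=> 1) eta); first by apply: eq_bigr => s _; rewrite mulr1.
by apply/esym/(@stab_ext_uniq _ (fun=> 1)) => // xi x _; rewrite topple_cst.
Qed.

Lemma stab_extE s : stab K lambda s =1 stab_ext (fun s' => (s' == s)%:R).
Proof.
by apply: stab_ext_uniq => [eta x|s']; [exact: stab_topple | exact: stab_stable].
Qed.

(** A particle may be added before or after stabilizing [eta]: both sides are harmonic in [eta] and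
    agree on stable configurations. *)
Lemma stab_ext_add f eta x :
  stab_ext f (add_active eta x) = stab_ext (fun s => stab_ext f (add_active (of_stable s) x)) eta.
Proof.
apply: (@stab_ext_uniq _ (fun xi => stab_ext f (add_active xi x))) => // xi y ay.
rewrite topple_add // stab_ext_topple //; exact: active_add.
Qed.

(* At a site with two particles, falling asleep has no effect. *)
Lemma stab_ext_jump f eta x : active eta x ->
  stab_ext f (add_active eta x) = \sum_y K x y * stab_ext f (add_active eta y)
    + kill_rate K x * stab_ext f eta.
Proof.
move=> ax; have [k ek] := active_cases ax.
have := stab_ext_topple f (active_add x ax).
rewrite /topple !sum_option /= {1}/try_sleep ffunE eqxx ek.
have -> : remove_active (add_active eta x) x = eta.
  by apply/ffunP => z; rewrite /remove_active /nb_active !ffunE; case: eqP => // ->; rewrite eqxx ek.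
move=> h; apply: (addIr (lambda * stab_ext f (add_active eta x))).
by transitivity ((1 + lambda) * stab_ext f (add_active eta x)); [ring | rewrite -h; ring].
Qed.

End Uniqueness.

(** * Exponential series and Poisson averages *)

Lemma sum_triangle (R : nmodType) (F : nat -> nat -> R) n :
  \sum_(0 <= k < n) \sum_(0 <= i < k.+1) F i (k - i)%N =
  \sum_(0 <= i < n) \sum_(0 <= j < n - i) F i j.
Proof.
elim: n => [|n IH]; first by rewrite !big_nil.
rewrite big_nat_recr //= IH [RHS]big_nat_recr //= subSnn big_nat1.
rewrite [X in _ + X]big_nat_recr //= addrA -big_split /= subnn; congr (_ + _).
rewrite !big_nat; apply: eq_bigr => i /andP[_ lin].
by rewrite subSn ?(ltnW lin) // big_nat_recr.
Qed.

Section PoissonAverage.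
Variable R : realType.
Implicit Types (x : R) (a : nat -> R).

Definition exp_series x a : nat -> R := series (fun i => x ^+ i / i`!%:R * a i).

Lemma is_cvg_exp_series x a : 0 <= x -> (forall i, 0 <= a i <= 1) -> cvgn (exp_series x a).
Proof.
move=> x0 a01; apply: (@series_le_cvg R _ (exp_coeff x)).
- by move=> i; rewrite mulr_ge0 ?divr_ge0 ?exprn_ge0 //; case/andP: (a01 i).
- by move=> i; rewrite /exp_coeff /= divr_ge0 ?exprn_ge0.
- move=> i; rewrite /exp_coeff /= ler_piMr ?divr_ge0 ?exprn_ge0 //.
  by case/andP: (a01 i).
- exact: is_cvg_series_exp_coeff.
Qed.

(* Product of the two series; the error is at most
   [(\sum_(i < n) x^i/i!)^2 - \sum_(k < n) (2x)^k/k!], which tends to 0. *)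
Lemma cvg_exp_product x a : 0 <= x -> (forall i, 0 <= a i <= 1) ->
  (fun n => \sum_(0 <= k < n) \sum_(0 <= i < k.+1)
     (x ^+ i / i`!%:R * a i) * ((- x) ^+ (k - i) / (k - i)`!%:R)) @ \oo -->
  limn (exp_series x a) * expR (- x).
Proof.
move=> x0 a01.
pose p i : R := x ^+ i / i`!%:R.
pose q j : R := (- x) ^+ j / j`!%:R.
have p0 i : 0 <= p i by rewrite /p divr_ge0 ?exprn_ge0.
have nq j : `|q j| = p j by rewrite /q /p normrM normfV normr_nat normrX normrN ger0_norm.
have na i : `|p i * a i| <= p i.
  by have /andP[a0 a1] := a01 i; rewrite normrM !ger0_norm // ler_piMr.
have tailE (F : nat -> nat -> R) n : (\sum_(0 <= i < n) \sum_(0 <= j < n) F i j) -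
    \sum_(0 <= i < n) \sum_(0 <= j < n - i) F i j =
    \sum_(0 <= i < n) \sum_(n - i <= j < n) F i j.
  rewrite -sumrB; apply: eq_bigr => i _.
  by rewrite [in X in X - _](big_cat_nat (n := (n - i)%N)) ?leq_subr //= addrAC subrr add0r.
have seriesM (u v : nat -> R) n :
    series u n * series v n = \sum_(0 <= i < n) \sum_(0 <= j < n) u i * v j.
  by rewrite /series /= mulr_suml; apply: eq_bigr => i _; rewrite mulr_sumr.
have bound n : `|exp_series x a n * series q n -
    \sum_(0 <= k < n) \sum_(0 <= i < k.+1) (p i * a i) * q (k - i)%N| <=
    series p n * series p n - series (exp_coeff (x + x)) n.
  have -> : series (exp_coeff (x + x)) n = \sum_(0 <= i < n) \sum_(0 <= j < n - i) p i * p j.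
    rewrite -sum_triangle; apply: eq_bigr => k _.
    rewrite /exp_coeff /= exprDn mulr_suml -(big_mkord xpredT
      (fun i => (x ^+ (k - i) * x ^+ i *+ 'C(k, i)) / k`!%:R)) !big_nat.
    apply: eq_bigr => i /andP[_]; rewrite ltnS => ik; rewrite /p -mulr_natr.
    have := bin_fact ik => /(congr1 (fun m => m%:R : R)); rewrite !natrM => e.
    have f0 m : m`!%:R != 0 :> R by rewrite pnatr_eq0 -lt0n fact_gt0.
    have -> : ('C(k, i))%:R = k`!%:R / (i`!%:R * (k - i)`!%:R) :> R.
      by rewrite -e mulfK // mulf_neq0.
    by field; rewrite !f0.
  rewrite (sum_triangle (fun i j => (p i * a i) * q j)) /exp_series !seriesM.
  rewrite (tailE (fun i j => (p i * a i) * q j)) (tailE (fun i j => p i * p j)).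
  apply: (le_trans (ler_norm_sum _ _ _)); apply: ler_sum => i _.
  apply: (le_trans (ler_norm_sum _ _ _)); apply: ler_sum => j _.
  by rewrite normrM nq ler_wpM2r.
have cp : series p @ \oo --> expR x by exact: is_cvg_series_exp_coeff.
have cq : series q @ \oo --> expR (- x) by exact: is_cvg_series_exp_coeff.
have ca := is_cvg_exp_series x0 a01.
have c0 : (fun n => series p n * series p n - series (exp_coeff (x + x)) n) @ \oo --> (0 : R).
  rewrite [X in _ --> X](_ : 0 = expR x * expR x - expR (x + x)); last by rewrite expRD subrr.
  by apply: cvgB; [exact: cvgM | exact: is_cvg_series_exp_coeff].
have c1 : (fun n => exp_series x a n * series q n -
    \sum_(0 <= k < n) \sum_(0 <= i < k.+1) (p i * a i) * q (k - i)%N) @ \oo --> (0 : R).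
  apply: norm_cvg0; apply: (squeeze_cvgr _ (cvg_cst 0) c0).
  by apply: nearW => n; rewrite normr_ge0 bound.
rewrite [X in _ --> X](_ : _ = limn (exp_series x a) * expR (- x) - 0); last by rewrite subr0.
rewrite [X in X @ _](_ : _ = (fun n => exp_series x a n * series q n -
  (exp_series x a n * series q n - \sum_(0 <= k < n) \sum_(0 <= i < k.+1) (p i * a i) * q (k - i)%N))).
  by apply: cvgB => //; exact: cvgM.
by apply/funext => n; rewrite subKr.
Qed.

End PoissonAverage.

Section PoissonLimit.
Variable R : realType.
Implicit Types (x : R) (a : nat -> R).

(** The Poisson weight of a fixed [i] vanishes as [x] grows, since the next term of the exponential
    series is already at most [expR x]. *)
Lemma exp_term_le x i : 0 < x -> expR (- x) * (x ^+ i / i`!%:R) <= i.+1%:R / x.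
Proof.
move=> x0; rewrite expRN mulrC ler_pdivrMr ?expR_gt0 //.
have h : x ^+ i.+1 / i.+1`!%:R <= expR x.
  by apply: le_trans (expR_ge1Dxn i (ltW x0)); rewrite lerDr.
have e1 : x ^+ i / i`!%:R = i.+1%:R / x * (x ^+ i.+1 / i.+1`!%:R).
  have m0 : i.+1%:R != 0 :> R by rewrite pnatr_eq0.
  have f0 : i`!%:R != 0 :> R by rewrite pnatr_eq0 -lt0n fact_gt0.
  rewrite factS natrM exprS; move: (i.+1%:R) m0 => m m0.
  by field; rewrite m0 f0 gt_eqF.
by rewrite e1 ler_wpM2l ?divr_ge0 ?(ltW x0).
Qed.

(** A Poisson variable of large mean exceeds any fixed [J] with high probability, and beyond [J] the
    sequence is close to its limit. *)
Lemma poisson_average_limit a (l : R) : (forall i, 0 <= a i <= l) -> l <= 1 -> a @ \oo --> l ->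
  (fun x => limn (exp_series x a) * expR (- x)) @ +oo --> l.
Proof.
move=> al l1 cal; have l0 : 0 <= l by case/andP: (al 0%N) => /le_trans; apply.
have a01 i : 0 <= a i <= 1 by case/andP: (al i) => -> /le_trans ->.
apply/cvgrPdist_le => e e0; have e20 : 0 < e / 2 by rewrite divr_gt0.
have [J _ aJ] : \forall i \near \oo, l - a i <= e / 2.
  move/cvgrPdist_le: cal => /(_ _ e20); apply: filterS => i; apply: le_trans.
  exact: ler_norm.
pose S : R := \sum_(0 <= i < J) i.+1%:R.
have S0 : 0 <= S by apply: sumr_ge0.
(* Makes [S / x], a bound for the total weight below [J], at most [e / 2]. *)
exists (Num.max 1 (2 * S / e)); split; first by rewrite num_real.
move=> x; rewrite gt_max => /andP[x1 xS].
have x0 : 0 < x by apply: lt_trans x1.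
pose p i : R := x ^+ i / i`!%:R.
have p0 i : 0 <= p i by rewrite /p divr_ge0 ?exprn_ge0 // ltW.
have cp : series p @ \oo --> expR x by exact: is_cvg_series_exp_coeff.
have ca := is_cvg_exp_series (ltW x0) a01.
have cd : (fun n => (l * series p n - exp_series x a n) * expR (- x)) @ \oo -->
    (l * expR x - limn (exp_series x a)) * expR (- x).
  by apply: cvgM; [apply: cvgB => //; apply: cvgM => //; exact: cvg_cst | exact: cvg_cst].
have dE n : l * series p n - exp_series x a n = \sum_(0 <= i < n) p i * (l - a i).
  by rewrite /exp_series /series /= mulr_sumr -sumrB; apply: eq_bigr => i _; rewrite mulrBr mulrC.
have le1 i : p i * (l - a i) <= (if (i < J)%N then p i else 0) + e / 2 * p i.
  have /andP[ai0 ail] := al i.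
  case: ltnP => iJ; last by rewrite add0r mulrC ler_wpM2r ?aJ.
  apply: ler_wpDr; first by rewrite mulr_ge0 // ltW.
  by rewrite ler_piMr // (le_trans _ l1) // gerBl.
have pJ : (\sum_(0 <= i < J) p i) * expR (- x) <= e / 2.
  rewrite mulr_suml; apply: (@le_trans _ _ (S / x)).
    rewrite /S mulr_suml; apply: ler_sum => i _.
    by rewrite mulrC exp_term_le.
  by rewrite ler_pdivrMr //; move: xS; rewrite ltr_pdivrMr //; lra.
have up n : (J <= n)%N -> (\sum_(0 <= i < n) p i * (l - a i)) * expR (- x) <= e.
  move=> Jn; have le2 : \sum_(0 <= i < n) p i * (l - a i) <= \sum_(0 <= i < J) p i + e / 2 * expR x.
    apply: (le_trans (ler_sum _ (fun i _ => le1 i))); rewrite big_split /= lerD //.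
      rewrite (big_cat_nat (n := J)) //= [X in _ + X]big_nat_cond [X in _ + X]big1 ?addr0; last first.
        by move=> i /andP[/andP[Ji _] _]; rewrite ltnNge Ji.
      by rewrite !big_nat; apply: ler_sum => i /andP[_ ->].
    rewrite -mulr_sumr ler_wpM2l ?(ltW e20) //.
    apply: (@nondecreasing_cvgn_le _ (series p)); last exact: cvgP cp.
    by apply/nondecreasing_seqP => k; rewrite /series /= big_nat_recr //= lerDl.
  apply: (le_trans (ler_wpM2r (expR_ge0 _) le2)).
  by rewrite mulrDl -(mulrA (e / 2)) expRxMexpNx_1 mulr1 [leRHS]splitr lerD.
have lim_cd := cvg_lim (@Rhausdorff R) cd.
have -> : l - limn (exp_series x a) * expR (- x) = (l * expR x - limn (exp_series x a)) * expR (- x).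
  by rewrite mulrBl -(mulrA l) expRxMexpNx_1 mulr1.
rewrite -lim_cd ger0_norm.
  apply: limr_le; first exact: cvgP cd.
  by exists J => // n /= Jn; rewrite dE up.
apply: limr_ge; first exact: cvgP cd.
apply: nearW => n; rewrite dE mulr_ge0 ?expR_ge0 // sumr_ge0 // => i _.
by rewrite mulr_ge0 // subr_ge0; case/andP: (al i).
Qed.

End PoissonLimit.

(** * The semigroup, by uniformization *)

Section Semigroup.
Variables (R : realType) (V : finType) (K : V -> V -> R) (lambda : R).
Hypotheses (Kk : killed_kernel K) (lambda_gt0 : 0 < lambda).
Implicit Types (eta xi : config V) (x y z : V) (f g u : config V -> R).
Local Notation G := (generator K lambda).

Variable N : nat.

(** An upper bound for the total rate of moves with at most [N] particles; [+ 1] keeps it positive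
    when [N = 0]. *)
Definition unif_rate : R := N%:R * (1 + lambda) + 1.
Local Notation c := unif_rate.

(* The transition operator of the chain uniformized at rate [c], which is
   stochastic on the configurations with at most [N] particles. *)
Definition unif f : config V -> R := fun eta => f eta + c^-1 * G f eta.

Lemma unif_rate_gt0 : 0 < c.
Proof. by rewrite ltr_wpDl // mulr_ge0 // ltW // rate_gt0. Qed.

Lemma unifE f : G f = fun eta => c * (unif f eta - f eta).
Proof.
by apply/funext => eta; rewrite /unif addrAC subrr add0r mulVKf // gt_eqF ?unif_rate_gt0.
Qed.

Lemma sum_nb_active eta : (\sum_x nb_active eta x <= particles eta)%N.
Proof. by apply: leq_sum => x _; rewrite /nb_active; case: (eta x). Qed.

(** The rate [c] dominates the total rate of moves, so that [unif f eta] combines values of [f] with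
    nonnegative coefficients. *)
Lemma unif_le f g : (forall eta, (particles eta <= N)%N -> f eta <= g eta) ->
  forall eta, (particles eta <= N)%N -> unif f eta <= unif g eta.
Proof.
move=> fg eta pe.
have E h : unif h eta = h eta * (1 - c^-1 * ((\sum_x nb_active eta x)%:R * (1 + lambda))) +
    c^-1 * \sum_x (nb_active eta x)%:R * topple K lambda x h eta.
  rewrite /unif generatorE natr_sum.
  rewrite (eq_bigr (fun x => (nb_active eta x)%:R * topple K lambda x h eta -
     (nb_active eta x)%:R * ((1 + lambda) * h eta))) => [|x _]; last by rewrite mulrBr.
  by rewrite sumrB -mulr_suml; ring.
rewrite !E lerD //.
  rewrite ler_wpM2r ?fg // subr_ge0 mulrC ler_pdivrMr ?unif_rate_gt0 // mul1r.
  rewrite (@le_trans _ _ (N%:R * (1 + lambda))) ?lerDl //.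
  by rewrite ler_wpM2r ?ler_nat ?(leq_trans (sum_nb_active eta)) // ltW ?rate_gt0.
rewrite ler_wpM2l ?invr_ge0 ?(ltW unif_rate_gt0) //; apply: ler_sum => x _.
have [ax|] := boolP (active eta x).
  rewrite ler_wpM2l // le_topple // => m; rewrite fg //.
  by apply: leq_trans pe; exact: particles_apply_move.
by rewrite /active -eqn0Ngt => /eqP ->; rewrite !mul0r.
Qed.

Lemma unif_stable f s : unif f (of_stable s) = f (of_stable s).
Proof.
rewrite /unif generator_topple ?mulr0 ?addr0 // => x.
by have /forallP/(_ x)/negbTE -> := stable_of_stable s.
Qed.

Lemma unif1 eta : unif (fun=> 1) eta = 1.
Proof. by rewrite /unif generator_topple ?mulr0 ?addr0 // => x _; rewrite topple_cst. Qed.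

Lemma unif0 eta : unif (fun=> 0) eta = 0.
Proof. by rewrite /unif generator_topple ?mulr0 ?addr0 // => x _; rewrite topple_cst mulr0. Qed.

Lemma generatorZ a f eta : G (fun xi => a * f xi) eta = a * G f eta.
Proof.
rewrite !generatorE mulr_sumr; apply: eq_bigr => x _.
by rewrite toppleZ; ring.
Qed.

Lemma unifB f g eta : unif (fun xi => f xi - g xi) eta = unif f eta - unif g eta.
Proof. by rewrite /unif generatorB; ring. Qed.

Lemma iter_unifB k f g eta : iter k unif (fun xi => f xi - g xi) eta =
  iter k unif f eta - iter k unif g eta.
Proof.
elim: k f g => // k IH f g; rewrite !iterSr -IH; congr (iter _ _ _ _).
by apply/funext => xi; exact: unifB.
Qed.

Lemma iter_unifZ k a f eta : iter k unif (fun xi => a * f xi) eta = a * iter k unif f eta.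
Proof.
elim: k f => // k IH f; rewrite !iterSr -IH; congr (iter _ _ _ _).
by apply/funext => xi; rewrite /unif generatorZ; ring.
Qed.

(** The binomial expansion of the k-th power of [c * (unif - id)], by Pascal's rule. *)
Lemma iter_generatorE k f eta : iter k G f eta =
  \sum_(i < k.+1) c ^+ k * (-1) ^+ (k - i) * 'C(k, i)%:R * iter i unif f eta.
Proof.
elim: k f => [|k IH] f.
  by rewrite big_ord_recl big_ord0 /= bin0 subn0 !expr0; ring.
rewrite iterSr IH unifE.
under eq_bigr do rewrite iter_unifZ iter_unifB -iterSr.
rewrite [RHS]big_ord_recl /=.
pose a i := iter i unif f eta.
have shift : \sum_(i < k.+1) c ^+ k * (-1) ^+ (k - i) * 'C(k, i)%:R * (c * a i) =
   - (c ^+ k.+1 * (-1) ^+ k.+1 * a 0%N) - \sum_(i < k.+1)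
     c ^+ k.+1 * (-1) ^+ (k - i) * 'C(k, i.+1)%:R * a i.+1.
  rewrite big_ord_recl [in RHS]big_ord_recr /= (bin_small (ltnSn k)) bin0 subn0 mulr0 mul0r addr0.
  congr (_ + _); first by rewrite !exprS; ring.
  rewrite -sumrN; apply: eq_bigr => i _; rewrite /bump /= add1n.
  by rewrite -(subSS i k) subSn // !exprS; ring.
rewrite (eq_bigr (fun i : 'I_k.+1 => c ^+ k.+1 * (-1) ^+ (k - i) * 'C(k, i)%:R * a i.+1 -
  c ^+ k * (-1) ^+ (k - i) * 'C(k, i)%:R * (c * a i))); last first.
  by move=> i _; rewrite /a /= exprS; ring.
rewrite sumrB shift opprB opprK addrA -big_split /= addrC.
rewrite bin0 subn0 mulr1; congr (_ + _); apply: eq_bigr => i _.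
by rewrite /a /bump /= add1n subSS binS natrD /=; ring.
Qed.

Section Target.
Variable s : stable V.
Definition target_ind : config V -> R := fun xi => (xi == of_stable s)%:R.
Local Notation a := (fun i => iter i unif target_ind).

Lemma iter_unif_bounds i eta : (particles eta <= N)%N -> 0 <= a i eta <= 1.
Proof.
elim: i eta => [|i IH] eta pe; first by rewrite /= /target_ind ler0n lern1 leq_b1.
by rewrite iterS -(unif0 eta) -[X in _ && (_ <= X)](unif1 eta) !unif_le // => xi /IH /andP[].
Qed.

(** Stable configurations are absorbing. *)
Lemma iter_unif_mono i eta : (particles eta <= N)%N -> a i eta <= a i.+1 eta.
Proof.
elim: i eta => [|i IH] eta pe; last by rewrite !(iterS _ unif) unif_le.
rewrite /= /target_ind; case: eqP => [->|_].
  by rewrite unif_stable /target_ind eqxx.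
by rewrite mulr0n -(unif0 eta) unif_le // => xi _; exact: ler0n.
Qed.

Lemma iter_unif_stable i s' : a i (of_stable s') = (s' == s)%:R.
Proof.
elim: i => [|i IH]; last by rewrite iterS unif_stable.
by rewrite /= /target_ind (inj_eq (@of_stable_inj V)).
Qed.

(** The limit is in the kernel of [G], because [G] applied to the i-th iterate is [c] times an
    increment of a convergent sequence. *)
Lemma cvg_iter_unif eta : (particles eta <= N)%N -> (fun i => a i eta) @ \oo --> stab K lambda s eta.
Proof.
pose L xi := limn (fun i => a i xi).
have cL xi : (particles xi <= N)%N -> (fun i => a i xi) @ \oo --> L xi.
  move=> px; apply: nondecreasing_is_cvgn; last first.
    by exists 1 => _ [i _ <-]; case/andP: (iter_unif_bounds i px).
  by apply/nondecreasing_seqP => i; exact: iter_unif_mono.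
move=> pe; suff <- : L eta = stab K lambda s eta by apply: cL.
move: eta pe; apply: (@generator_uniq _ _ K lambda Kk lambda_gt0 N) => [xi px|xi _|s' ps].
- have c1 : (fun i => G (a i) xi) @ \oo --> G L xi.
    rewrite generatorE; under eq_fun do rewrite generatorE.
    apply: cvg_sum => x; have [ax|] := boolP (active xi x).
      apply: cvgM; first exact: cvg_cst.
      apply: cvgB; last by apply: cvgM; [exact: cvg_cst | exact: cL].
      apply: cvg_sum => m; apply: cvgM; first exact: cvg_cst.
      by apply: cL; apply: leq_trans px; exact: particles_apply_move.
    rewrite /active -eqn0Ngt => /eqP ->; rewrite mul0r; under eq_fun do rewrite mul0r.
    exact: cvg_cst.
  have c2 : (fun i => G (a i) xi) @ \oo --> c * (L xi - L xi).
    under eq_fun do rewrite unifE.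
    apply: cvgM; first exact: cvg_cst.
    by apply: cvgB; [rewrite (cvg_shiftS (fun i => a i xi)) |]; exact: cL.
  by rewrite (@cvg_unique R _ _ _ _ _ c1 c2) // subrr mulr0.
- by apply: generator_topple => x ax; exact: stab_topple.
- rewrite stab_stable //; apply: (cvg_lim (@Rhausdorff R)).
  by under eq_fun do rewrite iter_unif_stable; exact: cvg_cst.
Qed.

(** The exponential of [c * t * (unif - id)] is that of [c * t * unif] times [expR (- (c * t))]; the
    defining series is the Cauchy product of the two. *)
Lemma semigroupE (t : R) eta : 0 <= t -> (particles eta <= N)%N ->
  semigroup K lambda t target_ind eta =
  limn (exp_series (c * t) (fun i => a i eta)) * expR (- (c * t)).
Proof.
move=> t0 pe; apply: (cvg_lim (@Rhausdorff R)).
have ct0 : 0 <= c * t by rewrite mulr_ge0 // ltW // unif_rate_gt0.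
have := cvg_exp_product ct0 (fun i => iter_unif_bounds i pe).
apply: cvg_trans; apply: near_eq_cvg; apply: nearW => n.
apply: eq_bigr => k _; rewrite iter_generatorE mulr_sumr big_mkord; apply: eq_bigr => i _.
have ik : (i <= k)%N by rewrite -ltnS.
have f0 m : m`!%:R != 0 :> R by rewrite pnatr_eq0 -lt0n fact_gt0.
have -> : ('C(k, i))%:R = k`!%:R / (i`!%:R * (k - i)`!%:R) :> R.
  by rewrite -(bin_fact ik) !natrM mulfK // mulf_neq0.
rewrite (exprNn (c * t)) -[X in c ^+ X](subnKC ik) -[X in t ^+ X](subnKC ik) !exprMn !exprD.
by field; rewrite !f0.
Qed.

End Target.
End Semigroup.

(** At time [t] the semigroup averages the uniformized chain over a Poisson number of steps of mean
    proportional to [t]. *)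
Lemma stabilize_probE (R : realType) (V : finType) (K : V -> V -> R) (lambda : R) eta s :
  killed_kernel K -> 0 < lambda -> stabilize_prob K lambda eta s = stab K lambda s eta.
Proof.
move=> Kk lambda0; apply: (cvg_lim (@Rhausdorff R)).
set N := particles eta.
have a01 i := iter_unif_bounds Kk lambda0 s i (leqnn N).
have c0 : 0 < unif_rate lambda N by exact: unif_rate_gt0.
have ca := cvg_iter_unif Kk lambda0 (s := s) (leqnn N).
have al i : 0 <= iter i (unif K lambda N) (target_ind R s) eta <= stab K lambda s eta.
  have /andP[-> _] /= := a01 i; rewrite -(cvg_lim (@Rhausdorff R) ca).
  apply: (@nondecreasing_cvgn_le _ (fun i => iter i (unif K lambda N) (target_ind R s) eta)).
    by apply/nondecreasing_seqP => j; exact: iter_unif_mono.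
  exact: cvgP ca.
have l1 : stab K lambda s eta <= 1.
  rewrite -(cvg_lim (@Rhausdorff R) ca); apply: limr_le; first exact: cvgP ca.
  by apply: nearW => i; case/andP: (a01 i).
have h := poisson_average_limit al l1 ca.
have c1 : (fun t : R => unif_rate lambda N * t) @ +oo --> +oo.
  by apply: gt0_cvgMry => //; exact: cvg_id.
have := cvg_comp _ _ c1 h; apply: cvg_trans; apply: near_eq_cvg.
near=> t; rewrite /= (@semigroupE _ _ _ _ Kk lambda0 N s t eta) //; near: t.
Unshelve. all: by end_near. Qed.

(** * Discrete Dirichlet problems for the killed walk *)

Section Dirichlet.
Variables (R : realType) (V : finType) (K : V -> V -> R).
Hypothesis Kk : killed_kernel K.
Implicit Types (A B : {set V}) (x y z : V) (phi psi rhs : V -> R).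

Definition restricted A phi x : R := if x \in A then \sum_y K x y * phi y else 0.

Lemma restrictedB A phi psi x :
  restricted A (fun y => phi y - psi y) x = restricted A phi x - restricted A psi x.
Proof.
rewrite /restricted; case: ifP; rewrite ?subr0 // => _.
by rewrite -sumrB; apply: eq_bigr => y _; rewrite mulrBr.
Qed.

(** At a negative minimum, necessarily in [A], no killing can occur and all neighbours share the
    minimum, which contradicts [killed]. *)
Lemma minimum_principle A phi :
  (forall x, restricted A phi x <= phi x) -> forall x, 0 <= phi x.
Proof.
move=> sup x1; rewrite leNgt; apply/negP => phi1.
have [x0 _ min] := @arg_minP _ _ _ x1 predT phi isT.
have min0 : phi x0 < 0 by apply: le_lt_trans phi1; exact: min.
have key x : phi x = phi x0 -> x \in A /\
    \sum_y K x y * (phi y - phi x0) <= kill_rate K x * phi x0.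
  move=> ex; have := sup x; rewrite ex /restricted; case: ifP => [xA h|_]; last by rewrite leNgt min0.
  split=> //; under eq_bigr do rewrite mulrBr.
  by rewrite sumrB -mulr_suml /kill_rate; move: h; set S := \sum_y K x y; lra.
have Kpos x y : 0 <= K x y * (phi y - phi x0).
  by rewrite mulr_ge0 ?(kernel_ge0 Kk) // subr_ge0 min.
suff H : forall x, phi x = phi x0 -> False by exact: (H x0).
apply: (killed Kk) => [x kx /key[_ le]|x y Kxy IH /key[_ le]].
  have : 0 <= kill_rate K x * phi x0 by apply: le_trans le; apply: sumr_ge0.
  by rewrite pmulr_rge0 // leNgt min0.
apply: IH; apply/eqP; rewrite -subr_eq0.
have : \sum_y K x y * (phi y - phi x0) == 0.
  rewrite eq_le sumr_ge0 // andbT (le_trans le) //.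
  by rewrite mulr_ge0_le0 ?(kill_rate_ge0 Kk) // ltW.
rewrite psumr_eq0 // => /allP/(_ y); rewrite mem_index_enum => /(_ isT) /=.
by rewrite mulf_eq0 gt_eqF.
Qed.

Lemma dirichlet_uniq A phi psi :
  (forall x, phi x - restricted A phi x = psi x - restricted A psi x) -> phi =1 psi.
Proof.
move=> e x; apply/eqP; rewrite eq_le -subr_ge0 -[X in _ && X]subr_ge0; apply/andP; split.
  apply: (@minimum_principle A (fun y => psi y - phi y)) => y.
  by rewrite restrictedB; have := e y; lra.
apply: (@minimum_principle A (fun y => phi y - psi y)) => y.
by rewrite restrictedB; have := e y; lra.
Qed.

Definition dirichlet_mx A : 'M[R]_#|V| :=
  \matrix_(i, j) ((i == j)%:R - (enum_val i \in A)%:R * K (enum_val i) (enum_val j)).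

Lemma dirichlet_mxE A (v : 'cV[R]_#|V|) x :
  (dirichlet_mx A *m v) (enum_rank x) 0 =
  v (enum_rank x) 0 - restricted A (fun y => v (enum_rank y) 0) x.
Proof.
rewrite mxE; under eq_bigr do rewrite mxE mulrBl enum_rankK.
rewrite sumrB (bigD1 (enum_rank x)) //= eqxx mul1r big1 ?addr0; last first.
  by move=> i ix; rewrite eq_sym (negPf ix) mul0r.
congr (_ - _); rewrite /restricted; case: (x \in A).
  rewrite [RHS](reindex (@enum_val _ predT)) /=; last exact/onW_bij/enum_val_bij.
  by apply: eq_bigr => i _; rewrite mul1r enum_valK.
by rewrite big1 // => i _; rewrite !mul0r.
Qed.

(** In finite dimension, the existence of solutions follows from their uniqueness. *)
Lemma dirichlet_mx_unit A : dirichlet_mx A \in unitmx.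
Proof.
rewrite -unitmx_tr -row_free_unit -kermx_eq0; apply/rowV0P => v /sub_kermxP vM.
have e x : (dirichlet_mx A *m v^T) (enum_rank x) 0 = 0.
  by rewrite -[dirichlet_mx A]trmxK -trmx_mul vM trmx0 mxE.
apply/rowP => k; rewrite mxE -[k]enum_valK; set x := enum_val k.
have := @dirichlet_uniq A (fun y => v^T (enum_rank y) 0) (fun=> 0) _ x.
rewrite mxE; apply=> y; rewrite -dirichlet_mxE e /restricted.
by case: ifP => _; rewrite ?subr0 // big1 ?subr0 // => z _; rewrite mulr0.
Qed.

Definition solve A rhs x : R :=
  (invmx (dirichlet_mx A) *m \col_i rhs (enum_val i)) (enum_rank x) 0.

Lemma solveE A rhs x : solve A rhs x = rhs x + restricted A (solve A rhs) x.
Proof.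
apply/eqP; rewrite -subr_eq; apply/eqP.
by rewrite -dirichlet_mxE mulKVmx ?dirichlet_mx_unit // mxE enum_rankK.
Qed.

Lemma solve_uniq A rhs phi :
  (forall x, phi x = rhs x + restricted A phi x) -> phi =1 solve A rhs.
Proof.
by move=> e; apply: (@dirichlet_uniq A) => x; rewrite {1}e {1}solveE !addrK.
Qed.

Lemma solve_ge0 A rhs : (forall x, 0 <= rhs x) -> forall x, 0 <= solve A rhs x.
Proof. by move=> r0; apply: (@minimum_principle A) => x; rewrite [leRHS]solveE lerDr. Qed.

End Dirichlet.

(** * One walk of internal DLA *)

Section InternalDLA.
Variables (R : realType) (V : finType) (K : V -> V -> R).
Hypothesis Kk : killed_kernel K.
Implicit Types (A B : {set V}) (x y z : V) (f g h : {set V} -> R).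
Local Notation kappa := (kill_rate K).

(* Expectation of [f] at the set obtained from [A] by adding the first site
   outside [A] visited by a walk started at [x], if it is not killed before. *)
Definition settle f A x : R :=
  solve K A (fun y => if y \in A then kappa y * f A else f (y |: A)) x.

Lemma settle_out f A x : x \notin A -> settle f A x = f (x |: A).
Proof. by move=> /negbTE xA; rewrite /settle solveE // /restricted xA addr0. Qed.

Lemma settle_in f A x : x \in A ->
  settle f A x = \sum_y K x y * settle f A y + kappa x * f A.
Proof. by move=> xA; rewrite {1}/settle solveE // /restricted xA addrC. Qed.

Lemma settle_uniq f A (phi : V -> R) :
  (forall x, x \notin A -> phi x = f (x |: A)) ->
  (forall x, x \in A -> phi x = \sum_y K x y * phi y + kappa x * f A) ->
  phi =1 settle f A.
Proof.
move=> out inn; apply: solve_uniq => // x; rewrite /restricted.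
by case: (boolP (x \in A)) => xA; [rewrite inn // addrC | rewrite out // addr0].
Qed.

Lemma settle_cst c A x : settle (fun=> c) A x = c.
Proof.
apply/esym; move: x; apply: settle_uniq => // x _.
by rewrite -mulr_suml /kill_rate; ring.
Qed.

Lemma settleB f g A x : settle (fun B => f B - g B) A x = settle f A x - settle g A x.
Proof.
apply/esym; move: x; apply: settle_uniq => x xA; first by rewrite !settle_out.
rewrite (settle_in f) // (settle_in g) //; under [in RHS]eq_bigr do rewrite mulrBr.
by rewrite sumrB; ring.
Qed.

Lemma settleZ c f A x : settle (fun B => c * f B) A x = c * settle f A x.
Proof.
apply/esym; move: x; apply: settle_uniq => x xA; first by rewrite settle_out.
rewrite settle_in // mulrDr mulr_sumr; congr (_ + _); last by ring.
by apply: eq_bigr => y _; ring.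
Qed.

Lemma settleD f g A x : settle (fun B => f B + g B) A x = settle f A x + settle g A x.
Proof.
have := settleB f (fun B => -1 * g B) A x; rewrite settleZ mulN1r opprK => <-.
by congr (settle _ _ _); apply/funext => B; rewrite mulN1r opprK.
Qed.

Lemma settle_ge0 f A x : 0 <= f A -> (forall y, y \notin A -> 0 <= f (y |: A)) ->
  0 <= settle f A x.
Proof.
move=> fA fyA; apply: solve_ge0 => // y; case: ifPn => yA; last exact: fyA.
by rewrite mulr_ge0 ?(kill_rate_ge0 Kk).
Qed.

Lemma le_settle f g A x : f A <= g A -> (forall y, y \notin A -> f (y |: A) <= g (y |: A)) ->
  settle f A x <= settle g A x.
Proof.
move=> fA fyA; rewrite -subr_ge0 -settleB settle_ge0 ?subr_ge0 // => y yA.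
by rewrite subr_ge0 fyA.
Qed.

Lemma eq_settle f g A x : f A = g A -> (forall y, y \notin A -> f (y |: A) = g (y |: A)) ->
  settle f A x = settle g A x.
Proof.
move=> fA fyA; apply/eqP; rewrite eq_le !le_settle ?fA // => y yA; by rewrite fyA.
Qed.

Lemma settle_full f x : settle f [set: V]%SET x = f [set: V]%SET.
Proof.
rewrite (@eq_settle f (fun=> f [set: V]%SET)) ?settle_cst // => y.
by rewrite inE.
Qed.

(* Both sides solve the same Dirichlet problem in [x], and then in [z]. *)
Lemma settleC f A x z :
  settle (fun B => settle f B z) A x = settle (fun B => settle f B x) A z.
Proof.
pose F u v := settle (fun B => settle f B v) A u.
have Fin1 u v : u \in A -> F u v = \sum_y K u y * F y v + kappa u * settle f A v.
  by move=> uA; rewrite /F settle_in.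
have Fin2 u v : v \in A -> F u v = \sum_y K v y * F u y + kappa v * settle f A u.
  move=> vA; apply/esym; move: u; apply: settle_uniq => u uA.
    rewrite settle_out // settle_in ?inE ?vA ?orbT //; congr (_ + _).
    by apply: eq_bigr => y _; rewrite /F settle_out.
  transitivity (\sum_y \sum_w K v y * (K u w * F w y) +
      kappa u * (\sum_y K v y * settle f A y) + kappa v * (\sum_w K u w * settle f A w) +
      kappa v * kappa u * f A).
    rewrite (settle_in f uA) mulrDr !addrA mulrA; congr (_ + _ + _).
    rewrite mulr_sumr -big_split /=; apply: eq_bigr => y _.
    by rewrite Fin1 // mulrDr mulr_sumr; congr (_ + _); ring.
  rewrite exchange_big /= (settle_in f vA).
  under [X in _ = X + _]eq_bigr => w _ do rewrite mulrDr mulr_sumr.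
  rewrite [in RHS]big_split /= [X in _ = _ + X + _](_ : _ = kappa v * (\sum_w K u w * settle f A w)).
    rewrite (eq_bigr (fun w => \sum_y K u w * (K v y * F w y))); first by ring.
    by move=> w _; apply: eq_bigr => y _; ring.
  by rewrite mulr_sumr; apply: eq_bigr => w _; ring.
suff H : F x z = F z x by exact: H.
move: x z => u v.
have H1 w : w \notin A -> forall u, F u w = F w u.
  move=> wA {}u; apply/esym; move: u; apply: settle_uniq => u uA.
    rewrite /F (settle_out _ wA); have [-> //|uw] := eqVneq u w.
    have wu : w != u by rewrite eq_sym.
    by rewrite !settle_out ?inE ?negb_or ?uA ?wA ?uw ?wu // finset.setUCA.
  by rewrite Fin2.
have [vA|vA] := boolP (v \in A); last exact: H1.
have [uA|uA] := boolP (u \in A); last by rewrite (H1 u uA).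
have : (fun u => F u v) =1 (fun u => F v u); last exact.
apply: (@dirichlet_uniq _ _ _ Kk A) => {uA}u.
rewrite /restricted; have [uA|uA] := boolP (u \in A).
  by rewrite (Fin1 u v uA) (Fin2 v u uA) addrAC subrr add0r addrAC subrr add0r.
by rewrite (H1 u uA v).
Qed.

End InternalDLA.

(** * The internal DLA chain with uniform starting sites *)

Section InternalDLAChain.
Variables (R : realType) (V : finType) (K : V -> V -> R).
Hypotheses (Kk : killed_kernel K) (V_gt0 : (0 < #|V|)%N).
Implicit Types (A B : {set V}) (x y z : V) (f g h : {set V} -> R).
Local Notation full := [set: V]%SET.

Definition idla f A : R := #|V|%:R^-1 * \sum_x settle K f A x.

Let n0 : #|V|%:R != 0 :> R. Proof. by rewrite pnatr_eq0 -lt0n. Qed.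

Lemma idla_cst c A : idla (fun=> c) A = c.
Proof.
rewrite /idla (eq_bigr (fun=> c)) => [|x _]; last exact: settle_cst.
by rewrite sumr_const -(mulr_natl c) mulKf.
Qed.

Lemma idlaB f g A : idla (fun B => f B - g B) A = idla f A - idla g A.
Proof. by rewrite /idla -mulrBr -sumrB; congr (_ * _); apply: eq_bigr => x _; rewrite settleB. Qed.

Lemma idlaD f g A : idla (fun B => f B + g B) A = idla f A + idla g A.
Proof. by rewrite /idla -mulrDr -big_split; congr (_ * _); apply: eq_bigr => x _; rewrite settleD. Qed.

Lemma idlaZ c f A : idla (fun B => c * f B) A = c * idla f A.
Proof.
rewrite /idla mulrCA; congr (_ * _); rewrite mulr_sumr.
by apply: eq_bigr => x _; rewrite settleZ.
Qed.

Lemma idla_ge0 f A : 0 <= f A -> (forall y, y \notin A -> 0 <= f (y |: A)) -> 0 <= idla f A.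
Proof.
move=> fA fyA; rewrite mulr_ge0 ?invr_ge0 ?ler0n // sumr_ge0 // => x _.
exact: settle_ge0.
Qed.

Lemma le_idla f g A : f A <= g A -> (forall y, y \notin A -> f (y |: A) <= g (y |: A)) ->
  idla f A <= idla g A.
Proof.
move=> fA fyA; rewrite ler_wpM2l ?invr_ge0 ?ler0n // ler_sum // => x _.
exact: le_settle.
Qed.

Lemma eq_idla f g A : f A = g A -> (forall y, y \notin A -> f (y |: A) = g (y |: A)) ->
  idla f A = idla g A.
Proof. by move=> fA fyA; apply/eqP; rewrite eq_le !le_idla ?fA // => y yA; rewrite fyA. Qed.

Lemma idla_full f : idla f full = f full.
Proof. by rewrite (@eq_idla f (fun=> f full)) ?idla_cst // => y; rewrite inE. Qed.

(** [settleC] averaged over the starting site of one of the two walks. *)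
Lemma idla_settleC f x A : idla (fun B => settle K f B x) A = settle K (idla f) A x.
Proof.
rewrite /idla settleZ //; congr (_ * _).
under eq_bigr => z _ do rewrite settleC //.
apply: (@settle_uniq _ _ _ Kk _ _ (fun x => \sum_z settle K (fun B => settle K f B z) A x)).
  by move=> y yA; apply: eq_bigr => z _; rewrite settle_out.
move=> y yA; under eq_bigr => z _ do rewrite settle_in //.
rewrite big_split /= -mulr_sumr exchange_big /=; congr (_ + _).
by apply: eq_bigr => z _; rewrite mulr_sumr.
Qed.

Definition loss A : R := idla (fun B => (B == A)%:R) A.

Lemma setU1_neq A y : y \notin A -> (y |: A == A) = false.
Proof. by move=> yA; apply/eqP => e; rewrite -e setU11 in yA. Qed.

Lemma loss_ge0 A : 0 <= loss A.
Proof. by apply: idla_ge0 => [|y _]; rewrite ler0n. Qed.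

Lemma loss_full : loss full = 1.
Proof. by rewrite /loss idla_full eqxx. Qed.

Lemma idla_top f A : (forall y, y \notin A -> f (y |: A) = 0) -> idla f A = loss A * f A.
Proof.
move=> fA; rewrite (@eq_idla f (fun B => f A * (B == A)%:R)) ?idlaZ 1?mulrC ?eqxx ?mul1r //.
by move=> y yA; rewrite setU1_neq // mulr0 fA.
Qed.

(** As a function of the starting site, the difference solves the equation without source on [A] and
    is nonnegative outside [A]. *)
Lemma loss_mono A B : A \subset B -> loss A <= loss B.
Proof.
move=> AB; rewrite /loss /idla ler_wpM2l ?invr_ge0 ?ler0n // ler_sum // => x _.
rewrite -subr_ge0; move: x.
apply: (@minimum_principle _ _ _ Kk A) => x; rewrite restrictedB /restricted.
case: (boolP (x \in A)) => xA.
  rewrite (settle_in Kk _ xA) (settle_in Kk _ (fintype.subsetP AB _ xA)) !eqxx; lra.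
rewrite subrr (settle_out Kk _ xA) setU1_neq // subr0.
by apply: settle_ge0 => // [|y _]; rewrite ler0n.
Qed.

Definition idla_law t f : R := iter t idla f finset.set0.

Lemma iter_idlaB t f g A : iter t idla (fun B => f B - g B) A = iter t idla f A - iter t idla g A.
Proof.
elim: t f g => // t IH f g; rewrite !iterSr -IH; congr (iter _ _ _ _).
by apply/funext => B; exact: idlaB.
Qed.

Lemma iter_idlaD t f g A : iter t idla (fun B => f B + g B) A = iter t idla f A + iter t idla g A.
Proof.
elim: t f g => // t IH f g; rewrite !iterSr -IH; congr (iter _ _ _ _).
by apply/funext => B; exact: idlaD.
Qed.

Lemma iter_idlaZ t c f A : iter t idla (fun B => c * f B) A = c * iter t idla f A.
Proof.
elim: t f => // t IH f; rewrite !iterSr -IH; congr (iter _ _ _ _).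
by apply/funext => B; exact: idlaZ.
Qed.

Lemma iter_idla_cst t c A : iter t idla (fun=> c) A = c.
Proof.
elim: t => // t IH; rewrite iterSr -[RHS]IH; congr (iter _ _ _ _).
by apply/funext => B; exact: idla_cst.
Qed.

Lemma le_iter_idla t f g A : (forall B, f B <= g B) -> iter t idla f A <= iter t idla g A.
Proof.
by move=> fg; elim: t A => //= t IH A; apply: le_idla.
Qed.

End InternalDLAChain.

(** * Intertwining of the ARW chain with internal DLA *)

Section Intertwining.
Variables (R : realType) (V : finType) (K : V -> V -> R) (lambda : R).
Hypotheses (Kk : killed_kernel K) (lambda_gt0 : 0 < lambda) (V_gt0 : (0 < #|V|)%N).
Implicit Types (A B : {set V}) (x y z : V) (phi : stable V -> R) (s : stable V).
Local Notation full := [set: V]%SET.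
Local Notation ext := (stab_ext K lambda).

(* [s] outside [A]; on [A], one new active particle per site, which has also
   awakened the particle of [s] there, if any. *)
Definition awakened s A : config V :=
  [ffun x => if x \in A then Some (s x).+1 else of_stable s x].

Definition arw_lift s phi A : R := ext phi (awakened s A).

Lemma awakened0 s : awakened s finset.set0 = of_stable s.
Proof. by apply/ffunP => x; rewrite ffunE inE. Qed.

Lemma active_awakened s A x : x \in A -> active (awakened s A) x.
Proof. by move=> xA; rewrite /active /nb_active ffunE xA. Qed.

Lemma awakened_add s A x : x \notin A -> add_active (awakened s A) x = awakened s (x |: A).
Proof.
move=> xA; apply/ffunP => y; rewrite !ffunE in_setU1.
by case: eqP => [->|] //=; rewrite (negPf xA); case: (s x).
Qed.

(** As a function of [x], the left side solves the problem defining [settle]: outside [A] the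
    newcomer stays as the active particle of its site, while on [A] it is not alone and
    [stab_ext_jump] lets it walk on. *)
Lemma lift_add s phi A x : ext phi (add_active (awakened s A) x) = settle K (arw_lift s phi) A x.
Proof.
move: x; apply: (@settle_uniq _ _ _ Kk _ _ (fun x => ext phi (add_active (awakened s A) x))).
  by move=> x xA; rewrite awakened_add.
by move=> x xA; apply: stab_ext_jump => //; exact: active_awakened.
Qed.

Definition arw_step phi s : R := \sum_s' ARW_step K lambda (uniform_law R V) s s' * phi s'.

Lemma stepE phi s : arw_step phi s = #|V|%:R^-1 * \sum_x ext phi (add_active (of_stable s) x).
Proof.
rewrite /arw_step /ARW_step; under eq_bigr do rewrite mulr_suml.
rewrite exchange_big mulr_sumr; apply: eq_bigr => x _ /=; rewrite /stab_ext mulr_sumr.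
by apply: eq_bigr => s' _; rewrite stabilize_probE // mulrA.
Qed.

(** [stab_ext_add] brings the new particle in before the stabilization rather than after it, and
    [lift_add] lets it settle. *)
Lemma lift_step s phi : arw_lift s (arw_step phi) = idla K (arw_lift s phi).
Proof.
apply/funext => A; rewrite /idla; under eq_bigr do rewrite -lift_add stab_ext_add //.
rewrite /arw_lift /stab_ext exchange_big mulr_sumr; apply: eq_bigr => s' _ /=.
by rewrite stepE -mulr_sumr mulrCA.
Qed.

Lemma lift_iter_step t s phi : arw_lift s (iter t arw_step phi) = iter t (idla K) (arw_lift s phi).
Proof. by elim: t => //= t <-; rewrite lift_step. Qed.

Lemma arw_lift0 s phi : arw_lift s phi finset.set0 = phi s.
Proof. by rewrite /arw_lift awakened0 stab_ext_stable. Qed.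

Lemma iter_stepE t s phi : iter t arw_step phi s = idla_law K t (arw_lift s phi).
Proof. by rewrite -arw_lift0 lift_iter_step. Qed.

Definition one_each : config V := [ffun=> Some 1%N].

(** As a function of [x], the left side solves the settling problem on the full set, whose only
    solution is constant: the additional particle walks until it is killed. *)
Lemma ext_add_full phi eta x : (forall y, active eta y) ->
  ext phi (add_active eta x) = ext phi eta.
Proof.
move=> act.
rewrite -[RHS](settle_cst Kk (ext phi eta) full x); move: x.
apply: settle_uniq => // y; first by rewrite inE.
by move=> _; apply: stab_ext_jump.
Qed.

Lemma ext_full phi eta : (forall y, active eta y) -> ext phi eta = ext phi one_each.
Proof.
have [k] := ubnP (particles eta); elim: k eta => // k IH eta lk act.
have [e|] := boolP [forall x, eta x == Some 1%N].
  by congr (ext _ _); apply/ffunP => x; rewrite ffunE; apply/eqP/(forallP e).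
rewrite negb_forall => /existsP[x ex]; have [j ej] := active_cases (act x).
have j0 : (0 < j)%N by rewrite lt0n; apply: contraNneq ex => j0; rewrite ej j0.
have -> : eta = add_active (remove_active eta x) x.
  apply/ffunP => y; rewrite /remove_active /nb_active !ffunE eqxx; case: eqP => // ->.
  by rewrite ej /=; case: j j0 {ej}.
have act' y : active (remove_active eta x) y.
  rewrite /active /remove_active /nb_active ffunE; case: eqP => [_|_]; last exact: act.
  by rewrite ej.
rewrite ext_add_full // IH //; move: lk.
by rewrite -(particles_remove (act x)) ltnS.
Qed.

Lemma lift_full s phi : arw_lift s phi full = ext phi one_each.
Proof. by apply: ext_full => y; apply: active_awakened; rewrite inE. Qed.

End Intertwining.

(** * The filling time of internal DLA *)

Section FillingTime.
Variables (R : realType) (V : finType) (K : V -> V -> R).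
Hypotheses (Kk : killed_kernel K) (V_gt0 : (0 < #|V|)%N).
Variable q : R.
Hypotheses (loss_setC1 : forall w, loss K (~: [set w]%SET) = q) (q_half : q <= 2^-1).
Implicit Types (A B : {set V}) (x y z w : V) (f g h : {set V} -> R).
Local Notation full := [set: V]%SET.
Local Notation Q := (idla K).
Local Notation law := (idla_law K).

Lemma loss_le A : A != full -> loss K A <= q.
Proof.
rewrite -finset.subTset => /subsetPn[w _ wA]; rewrite -(loss_setC1 w).
by apply: loss_mono => //; apply/fintype.subsetP => x xA; rewrite !inE; apply: contraNneq wA => <-.
Qed.

Lemma q_ge0 : 0 <= q.
Proof. by have /card_gt0P[w _] := V_gt0; rewrite -(loss_setC1 w) loss_ge0. Qed.

Lemma idla_split f A :
  Q f A = loss K A * f A + Q (fun B => if B == A then 0 else f B) A.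
Proof.
have <- : Q (fun B => f A * (B == A)%:R) A = loss K A * f A by rewrite idlaZ // mulrC.
rewrite -idlaD //; congr (idla _ _ _); apply/funext => B.
by case: eqP => [->|_]; rewrite ?mulr1 ?mulr0 ?addr0 ?add0r.
Qed.

Lemma card_setC_U1 A y : y \notin A -> #|~: A| = #|~: (y |: A)|.+1.
Proof.
move=> yA; rewrite (cardsD1 y) inE yA add1n; congr _.+1; apply: eq_card => x.
by rewrite !inE negb_or.
Qed.

Lemma set_down_ind (P : {set V} -> Prop) :
  (forall A, (forall y, y \notin A -> P (y |: A)) -> P A) -> forall A, P A.
Proof.
move=> H A; have [k] := ubnP #|~: A|; elim: k A => // k IH A lk; apply: H => y yA.
by apply: IH; rewrite -ltnS -card_setC_U1.
Qed.

(** Signs propagate from larger sets to smaller ones: the inequality at [A] contains [f A] on its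
    right side only with the coefficient [loss K A], which is at most 1/2. *)
Lemma idla_max f : f full <= 0 -> (forall A, A != full -> f A <= Q f A) ->
  forall A, f A <= 0.
Proof.
move=> f0 sub; apply: set_down_ind => A IH.
have [-> //|nA] := eqVneq A full.
have := sub A nA; rewrite idla_split.
have : Q (fun B => if B == A then 0 else f B) A <= 0.
  rewrite -[leRHS](idla_cst Kk V_gt0 0 A) le_idla ?eqxx // => y yA.
  by rewrite setU1_neq // IH.
by have := loss_le nA; have := q_ge0; have := q_half; nra.
Qed.

(** [u A] is the expected time to fill [V] from [A]. Besides [u A] the equation at [A] involves only
    larger sets, so that it is solved by dividing by [1 - loss K A]; the induction step treats the
    sets with [k] vacant sites. *)
Lemma exists_filling_time : exists u : {set V} -> R,
  u full = 0 /\ forall A, A != full -> Q u A = u A - 1.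
Proof.
have [k] : exists k, (#|V| < k)%N by exists #|V|.+1.
suff H : forall k, exists u : {set V} -> R, u full = 0 /\
    forall A, (#|~: A| < k)%N -> A != full -> Q u A = u A - 1.
  move=> lk; have [u [u0 uA]] := H k; exists u; split=> // A nA; apply: uA => //.
  by apply: leq_ltn_trans lk; exact: max_card.
elim=> [|{}k [u [u0 IH]]]; first by exists (fun=> 0).
pose u' A := if #|~: A| == k then
  if A == full then 0 else (1 + Q (fun B => if B == A then 0 else u B) A) / (1 - loss K A)
  else u A.
have u'E A y : (#|~: A| <= k)%N -> y \notin A -> u' (y |: A) = u (y |: A).
  by move=> lA yA; rewrite /u' ltn_eqF // -card_setC_U1.
exists u'; split=> [|A]; first by rewrite /u' eqxx u0; case: ifP.
rewrite ltnS leq_eqVlt => /orP[/eqP eA|ltA] nA.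
  rewrite idla_split (@eq_idla _ _ _ Kk _ (fun B => if B == A then 0 else u B)) ?eqxx //; last first.
    by move=> y yA; rewrite u'E // eA.
  have -> : u' A = (1 + Q (fun B => if B == A then 0 else u B) A) / (1 - loss K A).
    by rewrite /u' eA eqxx (negPf nA).
  have : 1 - loss K A != 0.
    by rewrite subr_eq0 eq_sym lt_eqF // (le_lt_trans (loss_le nA)) // (le_lt_trans q_half) // invf_lt1 ?ltr1n.
  move: (Q _ _) (loss K A) => i l l1; by field.
rewrite (@eq_idla _ _ _ Kk u' u) => [||y yA]; last by rewrite u'E // ltnW.
  by rewrite IH // /u' ltn_eqF.
by rewrite /u' ltn_eqF.
Qed.

(** * A variance bound for functions with constant drift, and the vacancy of a given site *)

Section Variance.
Variables (alive : pred {set V}) (w : {set V} -> R) (drift : R).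
Hypothesis alive_down : forall A y, alive (y |: A) -> alive A.
Hypothesis w_drift : forall A, alive A -> Q w A = w A - drift.
Hypothesis drift_le1 : `|drift| <= 1.
Hypothesis w_step : forall A y, alive A -> y \notin A -> `|w (y |: A) - w A + drift| <= 1.

Lemma idla_square c A : alive A ->
  Q (fun B => (c + (w B - w A + drift)) ^+ 2) A <= c ^+ 2 + 1.
Proof.
move=> aA; pose xi B := w B - w A + drift.
have xi0 : Q xi A = 0.
  rewrite /xi (_ : (fun B => _) = (fun B => w B - (w A - drift))); last first.
    by apply/funext => B; ring.
  by rewrite idlaB // idla_cst // w_drift // subrr.
have -> : Q (fun B => (c + xi B) ^+ 2) A = c ^+ 2 + Q (fun B => xi B ^+ 2) A.
  have -> : (fun B => (c + xi B) ^+ 2) = (fun B => (c ^+ 2 + (2 * c) * xi B) + xi B ^+ 2).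
    by apply/funext => B; ring.
  by rewrite idlaD // idlaD // idla_cst // idlaZ // xi0 mulr0 addr0.
rewrite lerD2l -[leRHS](idla_cst Kk V_gt0 1 A) le_idla // => [|y yA].
  by rewrite /xi subrr add0r -real_normK ?num_real // exprn_ile1.
by rewrite -real_normK ?num_real // exprn_ile1 // w_step.
Qed.

(** While [alive] holds, [w] plus its accumulated drift is a martingale with increments at most 1 in
    absolute value, so that each step adds at most 1 to the second moment. Sets that are no longer
    alive stay so and count for zero. *)
Lemma law_variance t :
  law t (fun A => (alive A)%:R * (w A + t%:R * drift - w finset.set0) ^+ 2) <= t%:R.
Proof.
elim: t => [|t IH].
  by rewrite /idla_law /= mul0r addr0 subrr expr0n mulr0.
rewrite /idla_law iterSr.
apply: (@le_trans _ _ (law t (fun A =>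
    (alive A)%:R * (w A + t%:R * drift - w finset.set0) ^+ 2 + 1))); last first.
  by rewrite /idla_law iter_idlaD // iter_idla_cst // -natr1 lerD2r.
apply: le_iter_idla => // A; have [aA|naA] := boolP (alive A).
  rewrite mul1r; apply: le_trans (idla_square _ aA); apply: le_idla => // [|y yA].
    by rewrite aA mul1r -natr1 le_eqVlt; apply/orP; left; apply/eqP; ring.
  apply: (@le_trans _ _ (1 * (w (y |: A) + t.+1%:R * drift - w finset.set0) ^+ 2)).
    by rewrite ler_wpM2r ?sqr_ge0 // lern1 leq_b1.
  by rewrite -natr1 le_eqVlt; apply/orP; left; apply/eqP; ring.
rewrite mul0r add0r -[leRHS](idla_cst Kk V_gt0 1 A) le_idla // => [|y yA].
  by rewrite (negPf naA) mul0r.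
by rewrite (_ : alive (y |: A) = false) ?mul0r //; apply: contraNF naA => /alive_down.
Qed.

End Variance.

(** The probability that a walk from [x] visits [z] before being killed: with [z] as the only vacant
    site, a walk that is not killed ends there. *)
Definition hit_site z x : R := 1 - settle K (fun B => (B == ~: [set z]%SET)%:R) (~: [set z]%SET) x.

Lemma hit_site_bounds z x : 0 <= hit_site z x <= 1.
Proof.
rewrite /hit_site subr_ge0 gerBl settle_ge0 // andbT.
by rewrite -[leRHS](settle_cst Kk 1 (~: [set z]%SET) x) le_settle // => [|y _]; rewrite lern1 leq_b1.
Qed.

Lemma hit_siteE z x : x != z -> hit_site z x = \sum_y K x y * hit_site z y.
Proof.
move=> xz; rewrite {1}/hit_site settle_in ?inE // eqxx mulr1.
under [RHS]eq_bigr do rewrite mulrBr mulr1.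
by rewrite sumrB /kill_rate; ring.
Qed.

Lemma sum_hit_site z : \sum_x hit_site z x = #|V|%:R * (1 - q).
Proof.
rewrite sumrB sumr_const -(loss_setC1 z) /loss /idla mulrBr mulr1 mulVKf //.
by rewrite pnatr_eq0 -lt0n.
Qed.

Definition vacancy_weight z A : R := \sum_(y | y \notin A) hit_site z y.

Lemma vacancy_weight_U1 z A y : y \notin A ->
  vacancy_weight z (y |: A) = vacancy_weight z A - hit_site z y.
Proof.
move=> yA; rewrite /vacancy_weight [in RHS](bigD1 y) //= addrAC subrr add0r.
by apply: eq_bigl => x; rewrite !inE negb_or andbC.
Qed.

Lemma vacancy_weight_ge0 z A : 0 <= vacancy_weight z A.
Proof. by apply: sumr_ge0 => y _; case/andP: (hit_site_bounds z y). Qed.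

(** A walk settling at [y] removes [hit_site z y]. While [z] is vacant, [hit_site z] is harmonic on
    [A], so that a walk from [x] removes [hit_site z x] in expectation; the average over [x] is
    [1 - q]. *)
Lemma vacancy_weight_drift z A : z \notin A ->
  Q (vacancy_weight z) A = vacancy_weight z A - (1 - q).
Proof.
move=> zA; have e x : settle K (vacancy_weight z) A x = vacancy_weight z A - hit_site z x.
  apply/esym; move: x; apply: settle_uniq => // x xA; first by rewrite vacancy_weight_U1.
  rewrite hit_siteE; last by apply: contraNneq zA => <-.
  under [in RHS]eq_bigr do rewrite mulrBr.
  by rewrite sumrB -mulr_suml /kill_rate; ring.
rewrite /idla; under eq_bigr do rewrite e.
rewrite sumrB sumr_const sum_hit_site -[X in X - _]mulr_natl -mulrBr mulKf //.
by rewrite pnatr_eq0 -lt0n.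
Qed.

(** Chebyshev's inequality: the weight being nonnegative, the martingale exceeds its initial value
    by at least [(1 - q) * (t - #|V|)] when [z] is vacant. The factor 4 is the square of the bound 2
    for the inverse of [1 - q]. *)
Lemma law_vacant z t : (#|V| <= t)%N ->
  law t (fun A => (z \notin A)%:R) * (t%:R - #|V|%:R) ^+ 2 <= 4 * t%:R.
Proof.
move=> nt; have q0 := q_ge0; have q2 := q_half; have q1 : q < 1.
  by apply: le_lt_trans q_half _; rewrite invf_lt1 ?ltr1n.
have := @law_variance (fun A => z \notin A) (vacancy_weight z) (1 - q) _
  (@vacancy_weight_drift z) _ _ t.
have -> : vacancy_weight z finset.set0 = #|V|%:R * (1 - q).
  by rewrite -(sum_hit_site z); apply: eq_bigl => x; rewrite inE.
move=> H; apply: (@le_trans _ _ (4 * law t (fun A => (z \notin A)%:R *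
   (vacancy_weight z A + t%:R * (1 - q) - #|V|%:R * (1 - q)) ^+ 2))); last first.
  rewrite ler_wpM2l // H // => [A y||A y zA yA].
  - by rewrite !inE negb_or => /andP[].
  - by rewrite ger0_norm; lra.
  - rewrite vacancy_weight_U1 //.
    rewrite ler_norml; have /andP[h0 h1] := hit_site_bounds z y; by apply/andP; split; lra.
rewrite mulrC -!iter_idlaZ //; apply: le_iter_idla => // A.
case: (z \notin A); rewrite ?mulr0 ?mul0r ?mulr0 // mulr1 mul1r.
have Y0 := vacancy_weight_ge0 z A; set Y := vacancy_weight z A in Y0 *.
have nt' : 0 <= t%:R - #|V|%:R :> R by rewrite subr_ge0 ler_nat.
rewrite -addrA -mulrBl (_ : 4 = 2 ^+ 2); last by rewrite -natrX.
rewrite -exprMn; set d := t%:R - _ in nt' *.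
have h : d <= 2 * (Y + d * (1 - q)) by nra.
by rewrite lerXn2r // nnegrE // (le_trans nt' h).
Qed.

(** * Expected filling time: increments, tails and asymptotics *)

Section ExpectedTime.
Variable u : {set V} -> R.
Hypotheses (u_full : u full = 0) (u_drift : forall A, A != full -> Q u A = u A - 1).
Local Notation u0 := (u finset.set0).

(** A step fills at most one site. *)
Lemma card_le_filling_time A : #|~: A|%:R <= u A.
Proof.
rewrite -subr_le0; move: A; apply: idla_max => [|A nA].
  by rewrite u_full finset.setCT cards0 subrr.
rewrite idlaB // u_drift //.
suff : #|~: A|%:R - 1 <= Q (fun B => #|~: B|%:R) A by lra.
rewrite -[leLHS](idla_cst Kk V_gt0 (#|~: A|%:R - 1) A) le_idla // => [|y yA].
  by rewrite gerBl.
by rewrite (card_setC_U1 yA) -natr1 addrK.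
Qed.

Lemma filling_time_ge0 A : 0 <= u A.
Proof. exact: le_trans (card_le_filling_time A). Qed.

Let isfull A : R := (A == full)%:R.

Lemma idla_isfull_setC1 w : Q isfull (~: [set w]%SET) = 1 - q.
Proof.
rewrite -(loss_setC1 w) -{1}(idla_cst Kk V_gt0 1 (~: [set w]%SET)) /loss -idlaB //.
have nfull : (~: [set w]%SET == full) = false.
  by apply/eqP => /finset.setP/(_ w); rewrite !inE eqxx.
apply: eq_idla => // [|y yw]; first by rewrite eqxx /isfull nfull subrr.
rewrite setU1_neq // subr0 /isfull; move: yw; rewrite !inE negbK => /eqP ->.
by rewrite finset.setUCr eqxx.
Qed.

(** The difference is the expected time saved by an additional walk from [z]. This walk commutes
    with a step, and [u] has drift -1 except at [full], so that only the event that the additional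
    walk completes [V] contributes. *)
Lemma filling_time_settle_drift z A : A != full ->
  Q (fun B => u B - settle K u B z) A = u A - settle K u A z - settle K isfull A z.
Proof.
move=> nA; rewrite idlaB // idla_settleC // u_drift //.
have e B : Q u B = u B - 1 + isfull B.
  have [->|nB] := eqVneq B full; first by rewrite idla_full // /isfull eqxx subrK.
  by rewrite u_drift // /isfull (negPf nB) addr0.
rewrite (_ : Q u = (fun B => u B - 1 + isfull B)); last exact/funext.
by rewrite settleD // settleB // settle_cst //; ring.
Qed.

Lemma filling_time_settle_ge0 z A : 0 <= u A - settle K u A z.
Proof.
rewrite -oppr_le0; move: A; apply: idla_max => [|A nA].
  by rewrite settle_full // subrr oppr0.
have -> : Q (fun B => - (u B - settle K u B z)) A = - (Q (fun B => u B - settle K u B z) A).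
  rewrite -[RHS]add0r -[X in X - _](idla_cst Kk V_gt0 0 A) -idlaB //.
  by congr (idla _ _ _); apply/funext => B; rewrite add0r.
rewrite filling_time_settle_drift // lerN2 gerBl settle_ge0 // => [|y _]; exact: ler0n.
Qed.

(** Comparison with [2 - 2 * isfull]. In one step the saved time drops on average by the probability
    that the additional walk completes [V]. This vanishes unless a single site is vacant, and is
    then at most [1 <= 2 * (1 - q)], twice the probability that an ordinary step completes [V]. *)
Lemma filling_time_settle_le z A : u A - settle K u A z <= 2.
Proof.
have H B : u B - settle K u B z - (2 - 2 * isfull B) <= 0.
  move: B; apply: idla_max => [|B nB].
    by rewrite settle_full // subrr /isfull eqxx mulr1 subrr subr0.
  rewrite idlaB // [X in _ <= _ - X]idlaB // idlaZ // idla_cst // filling_time_settle_drift //.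
  rewrite {1}/isfull (negPf nB) mulr0 subr0.
  suff : settle K isfull B z <= 2 * Q isfull B by lra.
  have [/existsP[w wB]|] := boolP [exists w, w |: B == full]; last first.
    rewrite negb_exists => /forallP nfull.
    rewrite -[settle _ _ _ _](_ : 0 = _); last first.
      rewrite -[LHS](settle_cst Kk 0 B z); apply: eq_settle => // [|y _].
        by rewrite /isfull (negPf nB).
      by rewrite /isfull (negPf (nfull y)).
    by rewrite mulr_ge0 // idla_ge0 // => *; exact: ler0n.
  have eB : B = ~: [set w]%SET.
    have fB y : (y == w) || (y \in B) by rewrite -in_setU1 (eqP wB) inE.
    have nwB : w \notin B.
      apply: contraNN nB => wB'; apply/eqP/finset.setP => y; rewrite inE.
      by have := fB y; case: eqP => [->|].
    by apply/finset.setP => y; rewrite !inE; have := fB y; case: eqP => [-> _|_ /= ->] //=; apply/negbTE.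
  rewrite {2}eB idla_isfull_setC1; apply: (@le_trans _ _ 1); last by have := q_half; lra.
  rewrite -[leRHS](settle_cst Kk 1 B z) le_settle // => [|y _]; by rewrite /isfull lern1 leq_b1.
by have := H A; have : 0 <= isfull A := ler0n _ _; lra.
Qed.

Lemma filling_time_U1 z A : z \notin A -> 0 <= u A - u (z |: A) <= 2.
Proof.
by move=> zA; rewrite -(settle_out Kk) // filling_time_settle_ge0 filling_time_settle_le.
Qed.

Lemma filling_time_le A : u A <= 2 * #|~: A|%:R.
Proof.
move: A; apply: set_down_ind => A IH.
have [->|] := eqVneq A full; first by rewrite u_full mulr_ge0.
rewrite -finset.subTset => /subsetPn[y _ yA].
have := IH y yA; have /andP[_] := filling_time_U1 yA.
by rewrite (card_setC_U1 yA) -natr1; lra.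
Qed.

(** The increments of [u] lie between -2 and 0, an interval centred at the mean increment -1. *)
Lemma not_full_step A y : A != full -> y \notin A -> `|u (y |: A) - u A + 1| <= 1.
Proof.
move=> _ yA; have /andP[] := filling_time_U1 yA.
by rewrite ler_norml => *; apply/andP; split; lra.
Qed.

(** Chebyshev's inequality: as [u] is nonnegative, the martingale [u + t] exceeds its initial value
    by at least [t - u0] if [V] is not yet full. *)
Lemma filling_upper_tail t : u0 <= t%:R ->
  (1 - law t isfull) * (t%:R - u0) ^+ 2 <= t%:R.
Proof.
move=> ut; apply: (@le_trans _ _ (law t (fun A => (A != full)%:R * (u A + t%:R * 1 - u0) ^+ 2))).
  have -> : 1 - law t isfull = law t (fun A => 1 - isfull A).
    by rewrite /idla_law iter_idlaB // iter_idla_cst.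
  rewrite mulrC -iter_idlaZ //.
  apply: le_iter_idla => // A; rewrite /isfull; case: eqP => _ /=; first by rewrite subrr mulr0 mul0r.
  rewrite subr0 !mulr1 mul1r lerXn2r ?nnegrE ?subr_ge0 //; have := filling_time_ge0 A; lra.
apply: law_variance; rewrite ?normr1 //; last exact: not_full_step.
by move=> A y; apply: contraNneq => ->; rewrite finset.setUT.
Qed.

(** [law_variance] discards the full set, which is the event of interest here. The second moment is
    therefore bounded over all sets: on [full] it is the square of [u0 - t], which decreases until
    time [u0]. *)
Lemma filling_lower_tail t : t%:R <= u0 -> law t isfull * (u0 - t%:R) ^+ 2 <= t%:R.
Proof.
move=> tu; apply: (@le_trans _ _ (law t (fun A => (u A + t%:R - u0) ^+ 2))).
  rewrite mulrC -iter_idlaZ //; apply: le_iter_idla => // A; rewrite /isfull.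
  case: eqP => [->|_]; last by rewrite mulr0 sqr_ge0.
  by rewrite u_full add0r mulr1 -sqrrN opprB.
elim: t tu => [|t IH] tu; first by rewrite /idla_law /= addr0 subrr expr0n.
have tu' : t%:R <= u0 by apply: le_trans tu; rewrite ler_nat.
rewrite /idla_law iterSr -natr1 -[X in _ <= _ + X](iter_idla_cst Kk V_gt0 t 1 finset.set0).
apply: le_trans (lerD (IH tu') (lexx _)); rewrite /idla_law -iter_idlaD //.
apply: le_iter_idla => // A; have [->|nA] := eqVneq A full.
  by rewrite idla_full // u_full; lra.
apply: le_trans (@idla_square (fun A => A != full) u 1 u_drift _ not_full_step _ A nA); rewrite ?normr1 //.
by apply: le_idla => // [|y yA]; rewrite le_eqVlt; apply/orP; left; apply/eqP; ring.
Qed.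

Lemma law_sum (I : Type) (r : seq I) (F : I -> {set V} -> R) t :
  law t (fun A => \sum_(i <- r) F i A) = \sum_(i <- r) law t (F i).
Proof.
elim: r => [|i r IH].
  by rewrite big_nil; under eq_fun do rewrite big_nil; exact: iter_idla_cst.
rewrite big_cons -IH; under eq_fun do rewrite big_cons.
exact: iter_idlaD.
Qed.

(** The expected time left at time [t] is at least [u0 - t], and each vacant site contributes at
    most 2 to it. *)
Lemma filling_time_vacancies t : u0 <= t%:R + 2 * \sum_z law t (fun A => (z \notin A)%:R).
Proof.
have : u0 - t%:R <= law t u.
  elim: t => [|t IH]; first by rewrite subr0.
  rewrite /idla_law iterSr -natr1 opprD addrA lerBlDr; apply: le_trans IH _.
  rewrite -[X in _ <= _ + X](iter_idla_cst Kk V_gt0 t 1 finset.set0) -iter_idlaD //.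
  apply: le_iter_idla => // A; have [->|nA] := eqVneq A full.
    by rewrite idla_full // lerDl.
  by rewrite u_drift // subrK.
have : law t u <= 2 * \sum_z law t (fun A => (z \notin A)%:R).
  rewrite -law_sum -iter_idlaZ //; apply: le_iter_idla => // A.
  apply: le_trans (filling_time_le A) _; rewrite ler_wpM2l // -sumr_const.
  rewrite big_mkcond /=; apply: ler_sum => x _; rewrite inE.
  by case: (x \in A).
by lra.
Qed.

Lemma filling_time_bound t : (#|V| <= t)%N ->
  (u0 - t%:R) * (t%:R - #|V|%:R) ^+ 2 <= 8 * #|V|%:R * t%:R.
Proof.
move=> nt; have := filling_time_vacancies t; set S := \sum_z _ => uS.
have d0 : 0 <= (t%:R - #|V|%:R : R) ^+ 2 by exact: sqr_ge0.
apply: (@le_trans _ _ (2 * S * (t%:R - #|V|%:R) ^+ 2)); first by rewrite ler_wpM2r //; lra.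
rewrite -mulrA /S mulr_suml.
apply: (@le_trans _ _ (2 * \sum_(z : V) 4 * t%:R)).
  by rewrite ler_wpM2l // ler_sum // => z _; exact: law_vacant.
by rewrite sumr_const -mulr_natl; lra.
Qed.

End ExpectedTime.
End FillingTime.

(** * Positivity of the invariant law *)

Section StablePositivity.
Variables (R : realType) (V : finType) (K : V -> V -> R) (lambda : R).
Hypotheses (Kk : killed_kernel K) (lambda_gt0 : 0 < lambda).
Implicit Types (eta : config V) (x y : V) (s : stable V).
Local Notation stab := (stab K lambda).

Lemma stab_gt0_move s eta x m : active eta x -> 0 < weight K lambda x m ->
  0 < stab s (apply_move x m eta) -> 0 < stab s eta.
Proof.
move=> ax wm sm; rewrite -(pmulr_rgt0 _ (rate_gt0 lambda_gt0)) -(stab_topple Kk lambda_gt0 s ax).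
rewrite /topple (bigD1 m) //= ltr_pwDl ?mulr_gt0 // sumr_ge0 // => m' _.
by rewrite mulr_ge0 ?weight_ge0 ?stab_ge0.
Qed.

(** The additional particle may walk until it is killed; no particle sleeps, hence none is woken on
    the way. *)
Lemma stab_gt0_add s eta x : (forall y, eta y != None) -> 0 < stab s eta ->
  0 < stab s (add_active eta x).
Proof.
move=> awake s0; have rem y : remove_active (add_active eta y) y = eta.
  apply/ffunP => z; rewrite /remove_active /nb_active !ffunE eqxx; case: eqP => // ->.
  by case: (eta y) (awake y).
elim/(killed Kk): x => [x kx|x y Kxy IH].
  by apply: (@stab_gt0_move _ _ x (Some None)) => //=; rewrite ?active_add_self ?rem.
by apply: (@stab_gt0_move _ _ x (Some (Some y))) => //=; rewrite ?active_add_self ?rem.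
Qed.

(** The particles outside [s] may be killed one by one while none sleeps, after which those of [s]
    fall asleep. The proof goes through this history backwards. *)
Lemma stab_one_each_gt0 s : 0 < stab s (one_each V).
Proof.
pose eta1 : config V := [ffun x => Some (s x : nat)].
have pos1 : 0 < stab s eta1.
  pose m (r : seq V) : config V :=
    [ffun x => if s x then (if x \in r then Some 1%N else None) else Some 0%N].
  have H r : 0 < stab s (m r).
    elim: r => [|y r IH].
      have -> : m [::] = of_stable s by apply/ffunP => x; rewrite !ffunE.
      by rewrite stab_stable // eqxx.
    have [/andP[sy yr]|yr] := boolP (s y && (y \notin r)).
      have my : m (y :: r) y = Some 1%N by rewrite ffunE sy inE eqxx.
      apply: (@stab_gt0_move _ _ y None) => //; first by rewrite /active /nb_active my.
      rewrite /= /try_sleep my eqxx (_ : set_site _ _ _ = m r) //.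
      apply/ffunP => x; rewrite !ffunE inE; case: (eqVneq x y) => [->|] //=.
      by rewrite sy (negPf yr).
    suff -> : m (y :: r) = m r by [].
    apply/ffunP => x; rewrite !ffunE inE; case: (eqVneq x y) => [->|] //=.
    by move: yr; rewrite negb_and; case: (s y) => //=; case: (y \in r).
  have := H (enum V); rewrite (_ : m _ = eta1) //; apply/ffunP => x; rewrite !ffunE mem_enum.
  by case: (s x).
pose m (r : seq V) : config V := [ffun x => Some (s x || (x \in r) : nat)].
have H r : 0 < stab s (m r).
  elim: r => [|y r IH].
    by rewrite (_ : m [::] = eta1) //; apply/ffunP => x; rewrite !ffunE orbF.
  have [yr|yr] := boolP (s y || (y \in r)).
    rewrite (_ : m (y :: r) = m r) //; apply/ffunP => x; rewrite !ffunE inE.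
    by case: (eqVneq x y) => [->|] //=; rewrite yr orbT.
  rewrite (_ : m (y :: r) = add_active (m r) y); last first.
    apply/ffunP => x; rewrite !ffunE inE; case: (eqVneq x y) => [->|] //=.
    by rewrite (negPf yr) orbT.
  by apply: stab_gt0_add => // x; rewrite ffunE.
have := H (enum V); rewrite (_ : m _ = one_each V) //; apply/ffunP => x.
by rewrite !ffunE mem_enum orbT.
Qed.

End StablePositivity.

(** * Invariant law, separation distance and eigenvalues of the ARW matrix *)

Section Matrix.
Variables (R : realType) (V : finType) (K : V -> V -> R) (lambda : R).
Hypotheses (Kk : killed_kernel K) (lambda_gt0 : 0 < lambda) (V_gt0 : (0 < #|V|)%N).
Variable q : R.
Hypotheses (loss_setC1 : forall w, loss K (~: [set w]%SET) = q) (q_half : q <= 2^-1).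
Implicit Types (A B : {set V}) (x y z w : V) (phi : stable V -> R) (s : stable V) (i j : 'I_#|stable V|).
Local Notation full := [set: V]%SET.
Local Notation law := (idla_law K).
Local Notation step := (arw_step K lambda).
Local Notation lift := (arw_lift K lambda).
Local Notation P := (ARW K lambda (uniform_law R V)).
Local Notation ind j := (fun s => (s == enum_val j)%:R : R).

Definition filled t : R := law t (fun A => (A == full)%:R).

Lemma ARW_mulmx (phi : stable V -> R) i :
  \sum_j P i j * phi (enum_val j) = step phi (enum_val i).
Proof.
rewrite /arw_step [RHS](reindex (@enum_val _ predT)) /=; last exact/onW_bij/enum_val_bij.
by apply: eq_bigr => j _; rewrite mxE.
Qed.

Lemma ARW_expE t i j : (P ^+ t) i j = law t (lift (enum_val i) (ind j)).
Proof.
rewrite -iter_stepE //; elim: t i => [|t IH] i.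
  by rewrite expr0 mxE /= (inj_eq enum_val_inj).
rewrite exprS mxE; under eq_bigr do rewrite IH.
by rewrite (ARW_mulmx (iter t step (ind j))).
Qed.

Definition full_law : 'rV[R]_#|stable V| := \row_j stab K lambda (enum_val j) (one_each V).

Lemma full_lawE s j : full_law 0 j = lift s (ind j) full.
Proof. by rewrite lift_full // mxE stab_extE. Qed.

Lemma sum_enum_val (f : stable V -> R) : \sum_(j < #|stable V|) f (enum_val j) = \sum_s f s.
Proof. by rewrite [RHS](reindex (@enum_val _ predT)) //=; exact/onW_bij/enum_val_bij. Qed.

Let s0 : stable V := [ffun=> false].

Lemma lift_ge0 s j A : 0 <= lift s (ind j) A.
Proof. by rewrite /arw_lift -stab_extE // stab_ge0. Qed.

Lemma mul_lift s A j : \sum_i lift s (ind i) A * P i j = idla K (lift s (ind j)) A.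
Proof.
transitivity (\sum_s' stab K lambda s' (awakened s A) * step (ind j) s'); last by rewrite -lift_step.
rewrite -sum_enum_val; apply: eq_bigr => i _; rewrite /arw_lift -stab_extE // -ARW_mulmx.
congr (_ * _); rewrite (bigD1 j) //= eqxx mulr1 big1 ?addr0 // => k kj.
by rewrite (inj_eq enum_val_inj) (negPf kj) mulr0.
Qed.

Lemma full_law_invariant : invariant_law P full_law.
Proof.
split=> [j||]; first by rewrite mxE ltW // stab_one_each_gt0.
  by under eq_bigr do rewrite mxE; rewrite (sum_enum_val (fun s => stab K lambda s _)) sum_stab.
apply/rowP => j; rewrite mxE; under eq_bigr do rewrite (full_lawE s0).
by rewrite mul_lift // idla_full // -full_lawE.
Qed.

(** Only the event that [V] is full by time [t] is kept. *)
Lemma le_law_full t i j : filled t * full_law 0 j <= (P ^+ t) i j.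
Proof.
rewrite ARW_expE /filled mulrC -iter_idlaZ //; apply: le_iter_idla => // A.
case: eqP => [->|_]; last by rewrite mulr0 lift_ge0.
by rewrite mulr1 -full_lawE.
Qed.

Lemma filled_le1 t : filled t <= 1.
Proof.
rewrite /filled -[leRHS](iter_idla_cst Kk V_gt0 t 1 finset.set0); apply: le_iter_idla => // A.
by rewrite lern1 leq_b1.
Qed.

Lemma filled_cvg1 (e : R) : 0 < e -> exists t, 1 - filled t < e.
Proof.
move=> e0; have [u [u_full u_drift]] := exists_filling_time Kk loss_setC1 q_half.
set u0 := u finset.set0.
have u00 : 0 <= u0 by exact: (filling_time_ge0 Kk V_gt0 loss_setC1 q_half u_full u_drift).
have e4 : 0 < 4 / e by rewrite divr_gt0.
(* [2 * u0] ensures [t / 2 <= t - u0]; the tail bound would then give [e * (t / 2) ^ 2 <= t], which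
   [4 / e < t] excludes. *)
pose X := 2 * u0 + 4 / e + 1.
have Xt := truncnS_gt X; set t := (Num.truncn X).+1 in Xt.
exists t; rewrite ltNge; apply/negP => le.
have tu : u0 <= t%:R by move: Xt; rewrite /X; lra.
have := filling_upper_tail Kk V_gt0 loss_setC1 q_half u_full u_drift tu.
rewrite -/(filled t) -/u0 => H.
have te : 4 / e < t%:R by move: Xt; rewrite /X; lra.
rewrite ltr_pdivrMr // in te.
have t2 : t%:R / 2 <= t%:R - u0.
  by move: Xt; rewrite /X; lra.
have t0 : 0 < t%:R :> R by rewrite ltr0n.
have : e * (t%:R / 2) ^+ 2 <= t%:R.
  apply: le_trans H; apply: ler_pM; rewrite ?sqr_ge0 ?(ltW e0) //.
  by rewrite lerXn2r ?nnegrE ?divr_ge0 ?(ltW t0) // (le_trans _ t2) // divr_ge0 // ltW.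
nra.
Qed.

(** An invariant law dominates [filled t * full_law] for every [t], hence [full_law], and both have
    mass 1. *)
Lemma invariant_law_uniq mu : invariant_law P mu -> mu = full_law.
Proof.
case=> mu0 mu1 muP; have [_ pi1 _] := full_law_invariant.
have muPt t : mu *m P ^+ t = mu.
  by elim: t => [|t IH]; rewrite ?expr0 ?mulmx1 // exprS -[_ * _]/(_ *m _) mulmxA muP.
have le t j : filled t * full_law 0 j <= mu 0 j.
  have := congr1 (fun m : 'rV_ _ => m 0 j) (muPt t); rewrite mxE => <-.
  rewrite -[leLHS]mul1r -mu1 mulr_suml.
  by apply: ler_sum => i _; rewrite ler_wpM2l // le_law_full.
have le' j : full_law 0 j <= mu 0 j.
  rewrite leNgt; apply/negP => lt; have pi0 : 0 < full_law 0 j by exact: le_lt_trans lt.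
  have d0 : 0 < 1 - mu 0 j / full_law 0 j by rewrite subr_gt0 ltr_pdivrMr // mul1r.
  have [t ht] := filled_cvg1 d0.
  have := le t j; rewrite -ler_pdivlMr //; lra.
apply/rowP => j; apply/eqP; rewrite -subr_eq0.
have : \sum_i (mu 0 i - full_law 0 i) == 0 by rewrite sumrB mu1 pi1 subrr.
rewrite psumr_eq0 => [|i _]; last by rewrite subr_ge0.
by move=> /allP/(_ j); rewrite mem_index_enum => /(_ isT).
Qed.

Lemma stationaryE : stationary P = full_law.
Proof.
by apply: xget_unique => [|mu]; [exact: full_law_invariant | exact: invariant_law_uniq].
Qed.

Lemma particles_awakened0 A : particles (awakened s0 A) = #|A|.
Proof.
rewrite /particles -sum1_card [RHS]big_mkcond /=; apply: eq_bigr => x _.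
by rewrite ffunE; case: ifP; rewrite !ffunE.
Qed.

Lemma d_sepE t : d_sep P t = 1 - filled t.
Proof.
rewrite /d_sep stationaryE; set E := (X in sup X).
have pi0 j : 0 < full_law 0 j by rewrite mxE stab_one_each_gt0.
have ub : ubound E (1 - filled t).
  move=> _ [[i j] _ <-] /=; rewrite lerD2l lerN2 ler_pdivlMr //; exact: le_law_full.
have inE : E (1 - filled t).
  pose s1 : stable V := [ffun=> true].
  exists (enum_rank s0, enum_rank s1) => //=; congr (1 - _).
  rewrite ARW_expE enum_rankK /filled.
  apply: (canLR (mulfK _)); rewrite ?gt_eqF // mulrC -iter_idlaZ //.
  congr (iter _ _ _ _); apply/funext => A; case: eqP => [->|/eqP nA].
    by rewrite mulr1 -full_lawE.
  rewrite mulr0 /arw_lift -stab_extE // stab_particles // particles_awakened0 enum_rankK.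
  rewrite (eq_bigr (fun=> 1%N)) => [|x _]; last by rewrite ffunE.
  by rewrite sum1_card -finset.cardsT fintype.proper_card // finset.properEneq nA finset.subsetT.
by apply/eqP; rewrite eq_le ge_sup ?ub_le_sup //; [exists (1 - filled t) | exists (1 - filled t)].
Qed.

(** A left eigenvector is the stabilized law of one active particle on each site but [w], minus that
    of one on every site: a step leaves the first set unchanged with probability [q] and completes
    it otherwise. It is nonzero, as only the second law charges the configuration with all sites
    asleep. *)
Lemma eigenvalue_loss w : eigenvalue P q.
Proof.
apply/eigenvalueP; pose f j A := lift s0 (ind j) A.
have fw j : idla K (f j) (~: [set w]%SET) =
    q * (f j (~: [set w]%SET) - f j full) + f j full.
  rewrite -(loss_setC1 w) mulrC /loss -idlaZ //.
  rewrite -[X in _ + X](idla_cst Kk V_gt0 (f j full) (~: [set w]%SET)) -idlaD //.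
  apply: eq_idla => // [|y]; first by rewrite eqxx mulr1 subrK.
  move=> yw; rewrite setU1_neq // mulr0 add0r.
  by move: yw; rewrite !inE negbK => /eqP ->; rewrite finset.setUCr.
exists (\row_j (f j (~: [set w]%SET) - f j full)).
  apply/rowP => j; rewrite !mxE; under eq_bigr do rewrite mxE mulrBl.
  by rewrite sumrB !mul_lift // -/(f j) fw idla_full // /f; ring.
apply/eqP => /rowP/(_ (enum_rank ([ffun=> true] : stable V))); rewrite !mxE => /eqP.
rewrite subr_eq0 lt_eqF // /f -(full_lawE s0) mxE /arw_lift -stab_extE // enum_rankK.
rewrite stab_particles ?stab_one_each_gt0 // particles_awakened0.
rewrite (eq_bigr (fun=> 1%N)) => [|x _]; last by rewrite ffunE.
by rewrite sum1_card -finset.cardsT fintype.proper_card // finset.properEneq finset.subsetT andbT;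
  apply/eqP => /finset.setP/(_ w); rewrite !inE eqxx.
Qed.

(* At a maximal set where the lifted eigenvector does not vanish, the internal
   DLA chain only contributes its probability of staying put. *)
Lemma complex_eigenvalue phi psi (a b : R) :
  (forall s, step phi s = a * phi s - b * psi s) ->
  (forall s, step psi s = b * phi s + a * psi s) ->
  (exists s, (phi s != 0) || (psi s != 0)) -> b = 0 /\ exists A, a = loss K A.
Proof.
move=> ephi epsi [s nz]; pose f := lift s phi; pose g := lift s psi.
have lin c d (h k : stable V -> R) A :
    lift s (fun s => c * h s + d * k s) A = c * lift s h A + d * lift s k A.
  rewrite /arw_lift /stab_ext !mulr_sumr -big_split; apply: eq_bigr => s' _ /=; ring.
have ef A : idla K f A = a * f A - b * g A.
  rewrite /f -lift_step // -mulNr -lin; congr (arw_lift _ _ _ _ _).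
  by apply/funext => s'; rewrite ephi mulNr.
have eg A : idla K g A = b * f A + a * g A.
  rewrite /g -lift_step // -lin; congr (arw_lift _ _ _ _ _).
  by apply/funext => s'; rewrite epsi.
have nz0 : (f finset.set0 != 0) || (g finset.set0 != 0) by rewrite /f /g !arw_lift0.
case: (@arg_maxnP _ finset.set0 (fun A => (f A != 0) || (g A != 0)) (fun A => #|A|) nz0).
move=> A nzA maxA.
have zero y : y \notin A -> f (y |: A) = 0 /\ g (y |: A) = 0.
  move=> yA; have [|/norP[/negPn/eqP -> /negPn/eqP ->]//] := boolP ((f (y |: A) != 0) || (g (y |: A) != 0)).
  by move=> /maxA; rewrite cardsU1 yA /= add1n ltnn.
have := ef A; have := eg A; rewrite !idla_top // => [e2 e1|y /zero[]|y /zero[]] //.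
have h1 : (loss K A - a) * f A = - (b * g A) by rewrite mulrBl e1; ring.
have h2 : (loss K A - a) * g A = b * f A by rewrite mulrBl e2; ring.
have kf : ((loss K A - a) ^+ 2 + b ^+ 2) * f A = 0.
  by rewrite mulrDl expr2 -mulrA h1 mulrN mulrCA h2; ring.
have kg : ((loss K A - a) ^+ 2 + b ^+ 2) * g A = 0.
  by rewrite mulrDl expr2 -mulrA h2 mulrCA h1; ring.
have : (loss K A - a) ^+ 2 + b ^+ 2 == 0.
  by case/orP: nzA => nz'; apply/eqP/(mulIf nz'); rewrite mul0r.
rewrite paddr_eq0 ?sqr_ge0 // !sqrf_eq0 subr_eq0.
by case/andP => /eqP <- /eqP ->; split=> //; exists A.
Qed.

End Matrix.

(** * The relaxation time *)

Section RelaxationTime.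
Variables (R : realType) (V : finType) (K : V -> V -> R) (lambda : R).
Hypotheses (Kk : killed_kernel K) (lambda_gt0 : 0 < lambda) (V_gt0 : (0 < #|V|)%N).
Variable q : R.
Hypotheses (loss_setC1 : forall w, loss K (~: [set w]%SET) = q) (q_half : q <= 2^-1).
Local Notation P := (ARW K lambda (uniform_law R V)).

(** [eigenvalue] refers to row vectors, while the chain acts on functions as on columns. *)
Lemma eigenvalue_colP (F : fieldType) m (M : 'M[F]_m) a :
  eigenvalue M a -> exists2 v : 'cV_m, M *m v = a *: v & v != 0.
Proof.
rewrite /eigenvalue /eigenspace kermx_eq0 row_free_unit -unitmx_tr -row_free_unit -kermx_eq0.
case/rowV0Pn => v /sub_kermxP vM v0; exists v^T; last first.
  by apply: contraNneq v0 => e; rewrite -[v]trmxK e trmx0.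
apply/eqP; rewrite -subr_eq0 -mul_scalar_mx -mulmxBl.
by rewrite -[_ - _]trmxK -trmx_mul vM trmx0.
Qed.

Lemma eigenvalue_off1_le (z : R[i]) : eigenvalue (map_mx (real_complex R) P) z -> z != 1 ->
  ComplexField.Normc.normc z <= q.
Proof.
case: z => a b /eigenvalue_colP[v Mv v0] z1.
pose phi s := complex.Re (v (enum_rank s) 0); pose psi s := complex.Im (v (enum_rank s) 0).
have row s : \sum_j real_complex R (P (enum_rank s) j) * v j 0 = Complex a b * v (enum_rank s) 0.
  have := congr1 (fun w : 'cV_ _ => w (enum_rank s) 0) Mv; rewrite !mxE => <-.
  by apply: eq_bigr => j _; rewrite !mxE.
have stepE' (h : stable V -> R) s : arw_step K lambda h s = \sum_j P (enum_rank s) j * h (enum_val j).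
  by rewrite ARW_mulmx enum_rankK.
have ReD (y z : R[i]) : complex.Re (y + z) = complex.Re y + complex.Re z by case: y; case: z.
have ImD (y z : R[i]) : complex.Im (y + z) = complex.Im y + complex.Im z by case: y; case: z.
have [s|s||b0 [A aA]] := @complex_eigenvalue _ _ _ _ Kk lambda_gt0 phi psi a b.
- have := congr1 (@complex.Re R) (row s); rewrite (big_morph _ ReD (erefl _)) stepE' /= => e.
  rewrite (eq_bigr (fun j => complex.Re (real_complex R (P (enum_rank s) j) * v j 0))); last first.
    by move=> j _; rewrite /phi enum_valK; case: (v j 0) => x y /=; rewrite mul0r subr0.
  by rewrite e /phi /psi; case: (v _ _).
- have := congr1 (@complex.Im R) (row s); rewrite (big_morph _ ImD (erefl _)) stepE' /= => e.
  rewrite (eq_bigr (fun j => complex.Im (real_complex R (P (enum_rank s) j) * v j 0))); last first.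
    by move=> j _; rewrite /psi enum_valK; case: (v j 0) => x y /=; rewrite mul0r addr0.
  by rewrite e /phi /psi; case: (v _ _) => x y /=; rewrite addrC.
- have [i vi] : exists i, v i 0 != 0.
    apply/existsP; apply: contraR v0; rewrite negb_exists => /forallP v0.
    by apply/eqP/colP => i; rewrite mxE; apply/eqP; rewrite -[_ == _]negbK v0.
  exists (enum_val i); rewrite /phi /psi enum_valK; move: vi; case: (v i 0) => x y.
  by rewrite eq_complex /= negb_and.
(* The full set has loss 1 and would give the excluded eigenvalue. *)
have nA : A != [set: V]%SET.
  apply: contraNneq z1 => eA; rewrite aA b0 eA loss_full //.
rewrite /ComplexField.Normc.normc b0 expr0n addr0 sqrtr_sqr aA ger0_norm; last exact: loss_ge0.
exact: loss_le nA.
Qed.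

Lemma t_relE : t_rel P = (1 - q)^-1.
Proof.
rewrite /t_rel /spectral_radius_off1; set E := (X in sup X).
have q0 : 0 <= q by exact: q_ge0 loss_setC1.
have Eq : E q.
  exists (real_complex R q); last first.
    by rewrite /ComplexField.Normc.normc /= expr0n addr0 sqrtr_sqr ger0_norm.
  have /card_gt0P[w _] := V_gt0; split.
    by rewrite eigenvalue_map; exact: (@eigenvalue_loss _ _ _ _ Kk lambda_gt0 V_gt0 q).
  have q1 : q != 1 by rewrite lt_eqF // (le_lt_trans q_half) // invf_lt1 ?ltr1n.
  by apply: contraNneq q1 => -[->].
have ub : ubound E q by move=> _ [z [ez z1] <-]; exact: eigenvalue_off1_le.
suff -> : sup E = q by [].
by apply/eqP; rewrite eq_le ge_sup ?ub_le_sup //; [exists q | exists q].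
Qed.

End RelaxationTime.

(** * Random walk on a transitive graph *)

Section Graph.
Variables (R : realType) (T : finType) (e : rel T) (o : T) (n : nat).
Hypotheses (simple_e : simple_graph e) (connected_e : connected_graph e).
Hypotheses (transitive_e : vertex_transitive e).
Hypotheses (n_gt0 : (0 < n)%N) (card_T : #|T| = n.+1).
Local Notation V := (punctured o).
Local Notation W := (walk_matrix R e).
Local Notation K := (killed_walk R e o).
Implicit Types (x y z : T) (f g : T -> R).

Lemma sum_punctured (F : T -> R) : \sum_x F x = F o + \sum_(v : V) F (sval v).
Proof.
rewrite (bigD1 o) //=; congr (_ + _).
rewrite (reindex_omap (fun v : V => sval v) insub) /=.
  by apply: eq_bigl => v; rewrite valK eqxx andbT; exact: (valP v).
by move=> x xo; rewrite insubT.
Qed.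

Lemma card_punctured : #|V| = n.
Proof.
have := cardC1 o; rewrite card_T card_sig /= => <-.
by apply: eq_card => x; rewrite !inE.
Qed.

Lemma card_neighbours x y : #|e x| = #|e y|.
Proof.
have [s [es <-]] := transitive_e x y.
rewrite -!sum1_card [RHS](reindex_inj (@perm_inj _ s)).
by apply: eq_bigl => v; rewrite [RHS]es.
Qed.

Lemma card_neighbours_gt0 x : (0 < #|e x|)%N.
Proof.
have [y yx] : exists y, y != x.
  have /card_gt0P[y] : (0 < #|predC1 x|)%N by rewrite cardC1 card_T.
  by rewrite inE; exists y.
have /connectP[[|z p] /= ep le] := connected_e x y; first by rewrite -le eqxx in yx.
by case/andP: ep => exz _; apply/card_gt0P; exists z.
Qed.

Lemma walk_matrix_ge0 x y : 0 <= W x y.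
Proof. by rewrite /walk_matrix; case: ifP => // _; rewrite invr_ge0. Qed.

Lemma walk_matrix_gt0 x y : e x y -> 0 < W x y.
Proof. by move=> exy; rewrite /walk_matrix exy invr_gt0 ltr0n card_neighbours_gt0. Qed.

Lemma walk_matrix_sym x y : W x y = W y x.
Proof. by rewrite /walk_matrix (proj1 simple_e) (card_neighbours x y). Qed.

Lemma sum_walk_matrix x : \sum_y W x y = 1.
Proof.
rewrite /walk_matrix -big_mkcond /= sumr_const -[LHS]mulr_natr mulVf //.
by rewrite pnatr_eq0 -lt0n card_neighbours_gt0.
Qed.

Lemma kill_rate_killed_walk v : kill_rate K v = W (sval v) o.
Proof. by rewrite /kill_rate -(sum_walk_matrix (sval v)) sum_punctured addrK. Qed.

(** Induction along a path to [o]: at a neighbour of [o] the walk may be killed. *)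
Lemma killed_walk_kernel : killed_kernel K.
Proof.
split=> [v w|v|D Dkill Dstep v]; first exact: walk_matrix_ge0.
  by rewrite kill_rate_killed_walk walk_matrix_ge0.
have /connectP[p] := connected_e (sval v) o.
elim: p v => [|y p IH] v /=; first by move=> _ ov; have := valP v; rewrite /= -ov eqxx.
case/andP=> evy ep lo; have [yo|yo] := eqVneq y o.
  by apply: Dkill; rewrite kill_rate_killed_walk; apply: walk_matrix_gt0; rewrite yo in evy.
apply: (Dstep v (Sub y yo : V)); first exact: walk_matrix_gt0.
by apply: IH.
Qed.

Definition laplacian f x : R := f x - \sum_y W x y * f y.

(** A transitive graph is regular, which makes [W] symmetric. *)
Lemma laplacian_selfadjoint f g : \sum_x g x * laplacian f x = \sum_x laplacian g x * f x.
Proof.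
rewrite /laplacian; under eq_bigr do rewrite mulrBr mulr_sumr.
under [RHS]eq_bigr do rewrite mulrBl mulr_suml.
rewrite !sumrB exchange_big /=; congr (_ - _).
by apply: eq_bigr => x _; apply: eq_bigr => y _; rewrite walk_matrix_sym; ring.
Qed.

Lemma sum_laplacian f : \sum_x laplacian f x = 0.
Proof.
have := laplacian_selfadjoint f (fun=> 1).
under eq_bigr do rewrite mul1r; move=> ->; rewrite big1 // => x _.
by rewrite /laplacian; under eq_bigr do rewrite mulr1; rewrite sum_walk_matrix subrr mul0r.
Qed.

(** [h] is the expected hitting time of [o]. Its Laplacian at [o] is forced, since a Laplacian sums
    to zero over the [n.+1] vertices. *)
Lemma exists_hitting_time : exists h : T -> R, [/\ h o = 0, forall x, x != o -> 1 <= h x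
  & forall x, laplacian h x = 1 - n.+1%:R * (x == o)%:R].
Proof.
have Kk := killed_walk_kernel.
pose hv : V -> R := solve K [set: V]%SET (fun=> 1).
have hv0 v : 0 <= hv v by apply: solve_ge0.
have hvE v : hv v = 1 + \sum_w K v w * hv w by rewrite /hv {1}solveE // /restricted inE.
pose h x : R := if insub x is Some v then hv v else 0.
have ho : h o = 0 by rewrite /h insubF // eqxx.
have hV (v : V) : h (sval v) = hv v by rewrite /h valK.
have L1 x : x != o -> laplacian h x = 1.
  move=> xo; rewrite /laplacian sum_punctured ho mulr0 add0r -[x]/(sval (Sub x xo : V)) hV hvE.
  by under [in X in _ - X]eq_bigr do rewrite hV; rewrite addrK.
exists h; split=> // x.
  move=> xo; rewrite -[x]/(sval (Sub x xo : V)) hV hvE lerDl sumr_ge0 // => w _.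
  by rewrite mulr_ge0 ?walk_matrix_ge0.
have [->|xo] := eqVneq x o; last by rewrite mulr0 subr0 L1.
have := sum_laplacian h; rewrite sum_punctured.
under eq_bigr => v _ do rewrite L1 ?(valP v) //.
by rewrite sumr_const card_punctured mulr1 -natr1; lra.
Qed.

(* By transitivity and reversibility the hitting times of [o] from [w] and of
   [w] from [o] agree; the probability of hitting [o] before [w] is an affine
   function of the difference of the two hitting times. *)
Lemma loss_killed_walk (w : V) : loss K (~: [set w]%SET) = (n%:R - 1) / (2 * n%:R).
Proof.
have Kk := killed_walk_kernel.
have [h [ho h1 Lh]] := exists_hitting_time.
have [s [es sow]] := transitive_e o (sval w).
have eW x y : W (s x) (s y) = W x y by rewrite /walk_matrix es (card_neighbours (s x) x).
pose g x := h ((s^-1)%g x).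
have Lg x : laplacian g x = 1 - n.+1%:R * (x == sval w)%:R.
  have -> : laplacian g x = laplacian h ((s^-1)%g x).
    rewrite /laplacian; congr (_ - _); rewrite (reindex_inj (@perm_inj _ s)).
    by apply: eq_bigr => y _; rewrite /g permK -{1}[x](permKV s) eW.
  by rewrite Lh -sow (canF_eq (permKV s)).
have gw : g (sval w) = 0 by rewrite /g -sow permK.
have sg : \sum_x g x = \sum_x h x.
  by rewrite (reindex_inj (@perm_inj _ s)); apply: eq_bigr => x _; rewrite /g permK.
have sumdelta (f : T -> R) a : \sum_x f x * (1 - n.+1%:R * (x == a)%:R) = \sum_x f x - n.+1%:R * f a.
  under eq_bigr do rewrite mulrBr mulr1.
  rewrite sumrB; congr (_ - _); rewrite (bigD1 a) //= eqxx mulr1 mulrC big1 ?addr0 // => x xa.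
  by rewrite (negPf xa) !mulr0.
(* Self-adjointness applied to [g] and [h], whose sums are equal, leaves only the terms at [o] and
   [w]. *)
have sym : g o = h (sval w).
  have := laplacian_selfadjoint h g; under eq_bigr do rewrite Lh.
  under [RHS]eq_bigr do rewrite Lg mulrC.
  rewrite !sumdelta sg => /addrI/oppr_inj/mulfI; apply.
  by rewrite pnatr_eq0.
set H := h (sval w) in sym.
have H0 : 1 <= H by apply: h1; exact: (valP w).
pose k x := (H - h x + g x) / (2 * H).
have ko : k o = 1 by rewrite /k ho sym; field; rewrite gt_eqF //; lra.
have kw : k (sval w) = 0 by rewrite /k gw addr0 -/H subrr mul0r.
have Lk x : x != o -> x != sval w -> k x = \sum_y W x y * k y.
  move=> xo xw; have := Lh x; have := Lg x; rewrite (negPf xo) (negPf xw) !mulr0 !subr0.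
  rewrite /laplacian => /eqP; rewrite subr_eq => /eqP eg /eqP; rewrite subr_eq => /eqP eh.
  rewrite (eq_bigr (fun y => (2 * H)^-1 * (H * W x y - W x y * h y + W x y * g y))); last first.
    by move=> y _; rewrite /k; ring.
  rewrite -mulr_sumr big_split sumrB /= -mulr_sumr sum_walk_matrix /k eg eh; ring.
have ke (x : V) : settle K (fun B => (B == ~: [set w]%SET)%:R) (~: [set w]%SET) x = k (sval x).
  apply/esym; move: x; apply: settle_uniq => // x.
    move=> xw; rewrite setU1_neq //; move: xw; rewrite !inE negbK => /eqP ->.
    exact: kw.
  rewrite !inE eqxx mulr1 => xw; rewrite Lk; [|exact: (valP x)|by rewrite (inj_eq val_inj)].
  by rewrite sum_punctured ko mulr1 kill_rate_killed_walk addrC.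
rewrite /loss /idla card_punctured; under eq_bigr do rewrite ke.
(* As [g] and [h] have the same sum, [k] has mean 1/2 whatever the value of [H]. *)
have sk : \sum_x k x = n.+1%:R / 2.
  rewrite /k -mulr_suml big_split sumrB /= sg subrK sumr_const card_T -mulr_natr; field.
  by rewrite gt_eqF //; lra.
have -> : \sum_(v : V) k (sval v) = (n%:R - 1) / 2.
  by move: sk; rewrite sum_punctured ko -natr1; lra.
by field; rewrite pnatr_eq0 -lt0n.
Qed.

End Graph.

(** * From concentration of the filling time to cutoff *)

Section CutoffFromConcentration.
Variables (R : realType) (D : nat -> nat -> R) (u : nat -> R).
Hypothesis u_bounds : forall n, (0 < n)%N -> n%:R <= u n <= 2 * n%:R.
Hypothesis D_bounds : forall n t, (0 < n)%N -> 0 <= D n t <= 1.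
Hypothesis D_upper : forall n t, (0 < n)%N -> u n <= t%:R ->
  D n t * (t%:R - u n) ^+ 2 <= t%:R.
Hypothesis D_lower : forall n t, (0 < n)%N -> t%:R <= u n ->
  (1 - D n t) * (u n - t%:R) ^+ 2 <= t%:R.
Hypothesis u_excess : forall n t, (0 < n)%N -> (n <= t)%N ->
  (u n - t%:R) * (t%:R - n%:R) ^+ 2 <= 8 * n%:R * t%:R.

Definition sep_time n (eps : R) : R := inf [set t%:R | t in [set t : nat | D n t <= eps]].
Local Notation ts := sep_time.
Local Notation rt n := (Num.sqrt (n%:R : R)).

Lemma sqrt_nat_sqr n : rt n ^+ 2 = n%:R. Proof. by rewrite sqr_sqrtr. Qed.

Lemma sqrt_nat_ge1 n : (0 < n)%N -> 1 <= rt n.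
Proof. by move=> n0; rewrite -[leLHS]sqrtr1 ler_sqrt // ler1n. Qed.

(** The time is [u n + C * rt n] rounded up: [+ 1] absorbs the rounding, as [rt n] is at least 1,
    and [3 + C] bounds the time divided by [n], by [u n <= 2 * n]. *)
Lemma sep_time_le n (eps C : R) : (0 < n)%N -> 0 < eps -> 0 <= C -> 3 + C <= eps * C ^+ 2 ->
  exists2 t, D n t <= eps & t%:R <= u n + (C + 1) * rt n.
Proof.
move=> n0 e0 C0 Ce; have := sqrt_nat_sqr n; have := sqrt_nat_ge1 n0.
set s := rt n => s1 s2; have /andP[u1 u2] := u_bounds n0.
have s0 : 0 < s by apply: lt_le_trans s1.
have x0 : 0 <= u n + C * s.
  by rewrite addr_ge0 ?mulr_ge0 ?(ltW s0) // (le_trans _ u1).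
have /andP[t1 t2] := truncn_itv x0; set t := Num.truncn _ in t1 t2.
exists t.+1; last first.
  by rewrite -natr1 mulrDl mul1r; lra.
have tu : C * s <= t.+1%:R - u n by rewrite lerBrDl ltW.
have Cs0 : 0 <= C * s by rewrite mulr_ge0 // ltW.
have ut : u n <= t.+1%:R by lra.
have h := D_upper n0 ut.
have tn : t.+1%:R <= (3 + C) * s ^+ 2.
  have Cs : C * s <= C * s ^+ 2 by rewrite expr2 mulrA ler_peMr.
  by rewrite -natr1; nra.
have /andP[D0 _] := D_bounds t.+1 n0.
have sq : (C * s) ^+ 2 <= (t.+1%:R - u n) ^+ 2 by rewrite lerXn2r ?nnegrE //; lra.
have h2 : D n t.+1 * (C * s) ^+ 2 <= eps * (C * s) ^+ 2.
  apply: (@le_trans _ _ (D n t.+1 * (t.+1%:R - u n) ^+ 2)); first by rewrite ler_wpM2l.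
  apply: (le_trans h); apply: (le_trans tn).
  have -> : eps * (C * s) ^+ 2 = eps * C ^+ 2 * s ^+ 2 by ring.
  by rewrite ler_wpM2r // sqr_ge0.
have Cpos : 0 < C.
  rewrite lt_neqAle C0 andbT; apply: contraTneq Ce => <-.
  by rewrite expr0n mulr0 addr0 -ltNge.
by move: h2; rewrite ler_pM2r // exprn_gt0 // mulr_gt0.
Qed.

Lemma sep_time_ge n (eps C : R) t : (0 < n)%N -> 0 <= C -> 2 < (1 - eps) * C ^+ 2 ->
  D n t <= eps -> u n - C * rt n <= t%:R.
Proof.
move=> n0 C0 Ce De; have := sqrt_nat_sqr n; have := sqrt_nat_ge1 n0.
set s := rt n => s1 s2; have /andP[u1 u2] := u_bounds n0.
have s0 : 0 < s by apply: lt_le_trans s1.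
rewrite leNgt; apply/negP => lt.
have Cs0 : 0 <= C * s by rewrite mulr_ge0 // ltW.
have tu : t%:R <= u n by lra.
have h := D_lower n0 tu.
have e1 : 0 <= 1 - eps by rewrite leNgt; apply/negP => e1; have := sqr_ge0 C; nra.
have : (1 - eps) * (C * s) ^+ 2 <= 2 * s ^+ 2.
  apply: (@le_trans _ _ ((1 - D n t) * (u n - t%:R) ^+ 2)); last by rewrite s2; lra.
  apply: ler_pM => //; rewrite ?sqr_ge0 //; first by lra.
  by rewrite lerXn2r ?nnegrE //; lra.
have -> : (1 - eps) * (C * s) ^+ 2 = (1 - eps) * C ^+ 2 * s ^+ 2 by ring.
by rewrite ler_pM2r ?exprn_gt0 //; lra.
Qed.

Lemma sep_time_bounds (eps : R) : 0 < eps -> eps < 1 -> exists2 C : R, 0 < C &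
  forall n, (0 < n)%N -> 0 <= ts n eps /\ `|ts n eps - u n| <= C * rt n.
Proof.
move=> e0 e1; pose C1 := 4 / eps; pose C2 := 2 / (1 - eps).
have e1' : 0 < 1 - eps by rewrite subr_gt0.
have C10 : 0 < C1 by rewrite divr_gt0.
have C20 : 0 < C2 by rewrite divr_gt0.
have C1e : 3 + C1 <= eps * C1 ^+ 2.
  have -> : eps * C1 ^+ 2 = 4 * C1 by rewrite /C1; field; rewrite gt_eqF.
  have : 4 <= C1 by rewrite /C1 ler_pdivlMr // ler_piMr // ltW.
  by lra.
have C2e : 2 < (1 - eps) * C2 ^+ 2.
  have -> : (1 - eps) * C2 ^+ 2 = 2 * C2 by rewrite /C2; field; rewrite gt_eqF.
  have : 2 <= C2 by rewrite /C2 ler_pdivlMr //; lra.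
  by lra.
exists (C1 + 1 + C2); first by rewrite !addr_gt0.
move=> n n0; have s1 := sqrt_nat_ge1 n0.
have [t tD tle] := sep_time_le n0 e0 (ltW C10) C1e.
have lbE : lbound [set t%:R | t in [set t : nat | D n t <= eps]] (u n - C2 * rt n).
  by move=> _ [k Dk <-]; exact: sep_time_ge (ltW C20) C2e Dk.
have lb0 : lbound [set t%:R | t in [set t : nat | D n t <= eps]] (0 : R).
  by move=> _ [k Dk <-].
have ne : ([set t%:R | t in [set t : nat | D n t <= eps]] : set R) !=set0.
  by exists t%:R; exists t.
split; first exact: lb_le_inf.
have lo : u n - C2 * rt n <= ts n eps by exact: lb_le_inf.
have hi : ts n eps <= t%:R.
  by apply: ge_inf; [exists 0 | exists t].
have C1s : 0 <= (C1 + 1) * rt n by rewrite mulr_ge0 ?sqrtr_ge0 // addr_ge0 // ltW.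
have C2s : 0 <= C2 * rt n by rewrite mulr_ge0 ?sqrtr_ge0 // ltW.
by rewrite mulrDl ler_norml; apply/andP; split; lra.
Qed.

Lemma near_sqrt_le (d : R) : 0 < d -> \forall n \near \oo, rt n <= d * n%:R.
Proof.
move=> d0; near=> n.
have nd : d^-1 ^+ 2 <= n%:R by near: n; exact: nbhs_infty_ger.
have sd : d^-1 <= rt n.
  rewrite [leLHS](_ : _ = Num.sqrt (d^-1 ^+ 2)) ?ler_sqrt //.
  by rewrite sqrtr_sqr ger0_norm // invr_ge0 ltW.
rewrite -[in leRHS]sqrt_nat_sqr expr2 mulrA ler_peMl ?sqrtr_ge0 //.
by rewrite -ler_pdivrMl // mulr1.
Unshelve. all: by end_near. Qed.

(** [u_excess] is used at time [n + m] with [m] close to [d * n / 2]. If [u n] exceeded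
    [(1 + d) * n], its left side would be at least [d ^ 3 * n ^ 3 / 32], its right side being at
    most [16 * n ^ 2], so that [d ^ 3 * n <= 512]. *)
Lemma near_u_le (d : R) : 0 < d -> d <= 1 -> \forall n \near \oo, u n <= (1 + d) * n%:R.
Proof.
move=> d0 d1; near=> n.
have nd : 8 / d <= n%:R by near: n; exact: nbhs_infty_ger.
have nd2 : 513 / d ^+ 3 <= n%:R by near: n; exact: nbhs_infty_ger.
have n0 : (0 < n)%N by near: n; exact: nbhs_infty_gt.
rewrite ler_pdivrMr // mulrC in nd; rewrite ler_pdivrMr ?exprn_gt0 // in nd2.
have x0 : 0 <= d * n%:R / 2 by rewrite divr_ge0 // mulr_ge0 // ltW.
have /andP[m1 m2] := truncn_itv x0; set m := Num.truncn _ in m1 m2.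
have := u_excess n0 (leq_addr m n); rewrite natrD addrAC subrr add0r => h.
rewrite -(natr1 m) in m2.
have N0 : 0 < n%:R :> R by rewrite ltr0n.
move: m1 m2 h nd nd2; set M : R := m%:R; set N : R := n%:R in N0 *; set U := u n.
move=> m1 m2 h nd nd2; rewrite leNgt; apply/negP => lt.
have mlow : d * N / 4 <= M by lra.
have ulow : d * N / 2 <= U - (N + M) by lra.
have dN0 : 0 <= d * N by rewrite mulr_ge0 // ltW.
have dN : d * N <= N by rewrite ler_piMl // ltW.
have mN : M <= N by lra.
have big : d * N / 2 * (d * N / 4) ^+ 2 <= 16 * N ^+ 2.
  apply: (@le_trans _ _ ((U - (N + M)) * M ^+ 2)).
    apply: ler_pM; rewrite ?sqr_ge0 //.
    by rewrite lerXn2r ?nnegrE //; lra.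
  by apply: (le_trans h); nra.
have : d ^+ 3 * N <= 512.
  rewrite -(ler_pM2r (exprn_gt0 2 N0)).
  have -> : d ^+ 3 * N * N ^+ 2 = 32 * (d * N / 2 * (d * N / 4) ^+ 2) by field.
  by lra.
lra.
Unshelve. all: by end_near. Qed.

Lemma sep_time_equivalent : (fun n => ts n 2^-1 - n%:R) =o_\oo (fun n => n%:R : R).
Proof.
have [C C0 tsC] := @sep_time_bounds 2^-1 (ltac:(by rewrite invr_gt0)) (ltac:(by rewrite invf_lt1 ?ltr1n)).
apply/eqoP => eps e0; pose d := Num.min 1 (eps / 2).
have d0 : 0 < d by rewrite lt_min ltr01 divr_gt0.
have d1 : d <= 1 by rewrite ge_min lexx.
have de : d <= eps / 2 by rewrite ge_min lexx orbT.
near=> n; have n0 : (0 < n)%N by near: n; exact: nbhs_infty_gt.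
have [_ h] := tsC n n0.
have hu : u n <= (1 + d) * n%:R by near: n; exact: near_u_le.
have hs : rt n <= eps / (2 * C) * n%:R.
  by near: n; apply: near_sqrt_le; rewrite divr_gt0 // mulr_gt0.
have hs' : C * rt n <= eps / 2 * n%:R.
  have -> : eps / 2 = C * (eps / (2 * C)) by field; rewrite gt_eqF.
  by rewrite -mulrA ler_wpM2l // ltW.
have /andP[u1 _] := u_bounds n0.
have N0 : 0 <= n%:R :> R by [].
have dn : d * n%:R <= eps / 2 * n%:R by rewrite ler_wpM2r.
rewrite [X in _ <= _ * X]ger0_norm //; rewrite ler_norml in h; case/andP: h => h1 h2.
by rewrite ler_norml; apply/andP; split; lra.
Unshelve. all: by end_near. Qed.

Lemma sep_time_window (eps : R) : 0 < eps -> eps < 2^-1 ->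
  (fun n => ts n eps - ts n (1 - eps)) =O_\oo (fun n => rt n).
Proof.
move=> e0 e2; have e1 : eps < 1 by apply: lt_trans e2 _; rewrite invf_lt1 ?ltr1n.
have [C C0 tsC] := sep_time_bounds e0 e1.
have [C' C0' tsC'] := @sep_time_bounds (1 - eps) (ltac:(by rewrite subr_gt0)) (ltac:(by rewrite gtrBl)).
apply/eqOP; near=> k; near=> n.
have n0 : (0 < n)%N by near: n; exact: nbhs_infty_gt.
have [_ h] := tsC n n0; have [_ h'] := tsC' n n0.
have Ck : C + C' <= k by near: k; apply: nbhs_pinfty_ge; rewrite num_real.
rewrite [X in _ <= _ * X]ger0_norm ?sqrtr_ge0 //.
apply: (@le_trans _ _ ((C + C') * rt n)); last by rewrite ler_wpM2r ?sqrtr_ge0.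
rewrite mulrDl; have -> : ts n eps - ts n (1 - eps) = (ts n eps - u n) - (ts n (1 - eps) - u n) by ring.
by apply: (le_trans (ler_normB _ _)); rewrite lerD.
Unshelve. all: by end_near. Qed.

Lemma cvg_inv_nat (A : R) : (fun n => A / n%:R) @ \oo --> (0 : R).
Proof.
rewrite -[X in _ --> X](mulr0 A); apply: cvgM; first exact: cvg_cst.
by apply/gtr0_cvgV0; [near=> n; rewrite ltr0n; near: n; exact: nbhs_infty_gt | exact: cvgr_idn].
Unshelve. all: by end_near. Qed.

(** For large [n] the time falls short of [u n] by at least [(1 - a) / 2 * n], so that [D_lower]
    gives an error of order [1 / n]. *)
Lemma sep_cutoff_before (a : R) : 0 <= a -> a < 1 ->
  D n (Num.truncn (a * ts n 2^-1)) @[n --> \oo] --> (1 : R).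
Proof.
move=> a0 a1; have [C C0 tsC] := @sep_time_bounds 2^-1 (ltac:(by rewrite invr_gt0)) (ltac:(by rewrite invf_lt1 ?ltr1n)).
have b0 : 0 < 1 - a by rewrite subr_gt0.
suff c : (fun n => 1 - D n (Num.truncn (a * ts n 2^-1))) @ \oo --> (0 : R).
  rewrite (_ : (fun n => _) = (fun n => 1 - (1 - D n (Num.truncn (a * ts n 2^-1))))); last first.
    by apply/funext => n; rewrite subKr.
  by rewrite -[X in _ --> X](subr0 1); apply: cvgB c; exact: cvg_cst.
apply: (squeeze_cvgr _ (cvg_cst 0) (cvg_inv_nat (8 / (1 - a) ^+ 2))).
near=> n; have n0 : (0 < n)%N by near: n; exact: nbhs_infty_gt.
set t := Num.truncn _; have /andP[D0 D1] := D_bounds t n0.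
rewrite subr_ge0 D1 /=; have [ts0 h] := tsC n n0.
have hs : rt n <= (1 - a) / (2 * C) * n%:R.
  by near: n; apply: near_sqrt_le; rewrite divr_gt0 // mulr_gt0.
have hs' : C * rt n <= (1 - a) / 2 * n%:R.
  have -> : (1 - a) / 2 = C * ((1 - a) / (2 * C)) by field; rewrite gt_eqF.
  by rewrite -mulrA ler_wpM2l // ltW.
have /andP[u1 u2] := u_bounds n0.
rewrite ler_norml in h; case/andP: h => _ h2.
have /andP[t1 _] := truncn_itv (mulr_ge0 a0 ts0); rewrite -/t in t1.
have gap : (1 - a) / 2 * n%:R <= u n - t%:R.
  have : a * ts n 2^-1 <= a * (u n + C * rt n) by rewrite ler_wpM2l //; lra.
  have : a * (C * rt n) <= C * rt n by rewrite ler_piMl ?mulr_ge0 ?sqrtr_ge0 ?ltW.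
  have : (1 - a) * n%:R <= (1 - a) * u n by rewrite ler_wpM2l // ltW.
  by lra.
have N0 : 0 < n%:R :> R by rewrite ltr0n.
have gap0 : 0 <= (1 - a) / 2 * n%:R by rewrite mulr_ge0 // divr_ge0 // ltW.
have tu : t%:R <= u n by lra.
have := D_lower n0 tu => hD.
have : (1 - D n t) * ((1 - a) / 2 * n%:R) ^+ 2 <= 2 * n%:R.
  apply: (@le_trans _ _ ((1 - D n t) * (u n - t%:R) ^+ 2)); last by lra.
  rewrite ler_wpM2l ?subr_ge0 // lerXn2r ?nnegrE //; lra.
have -> : 2 * n%:R = 8 / (1 - a) ^+ 2 / n%:R * ((1 - a) / 2 * n%:R) ^+ 2 :> R.
  by field; rewrite !gt_eqF.
by rewrite ler_pM2r // exprn_gt0 // mulr_gt0 // divr_gt0.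
Unshelve. all: by end_near. Qed.

Lemma sep_cutoff_after (a : R) : 1 < a ->
  D n (Num.truncn (a * ts n 2^-1)) @[n --> \oo] --> (0 : R).
Proof.
move=> a1; have [C C0 tsC] := @sep_time_bounds 2^-1 (ltac:(by rewrite invr_gt0)) (ltac:(by rewrite invf_lt1 ?ltr1n)).
have b0 : 0 < a - 1 by rewrite subr_gt0.
have a0 : 0 < a by apply: lt_trans a1.
pose A := 4 * (a * (2 + C)) / (a - 1) ^+ 2.
apply: (squeeze_cvgr _ (cvg_cst 0) (cvg_inv_nat A)).
near=> n; have n0 : (0 < n)%N by near: n; exact: nbhs_infty_gt.
set t := Num.truncn _; have /andP[D0 D1] := D_bounds t n0.
rewrite D0 /=; have [ts0 h] := tsC n n0.
(* Of the margin [(a - 1) * n], a quarter covers the deviation of the separation time from [u n] and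
   a quarter the rounding. *)
have hs : rt n <= (a - 1) / (4 * a * C) * n%:R.
  by near: n; apply: near_sqrt_le; rewrite divr_gt0 // !mulr_gt0.
have hs' : a * (C * rt n) <= (a - 1) / 4 * n%:R.
  have -> : (a - 1) / 4 = a * C * ((a - 1) / (4 * a * C)) by field; rewrite !gt_eqF.
  by rewrite mulrA -[leRHS]mulrA ler_wpM2l // mulr_ge0 // ltW.
have h1n : 1 <= (a - 1) / 4 * n%:R.
  rewrite -ler_pdivrMl ?divr_gt0 // mulr1; near: n; exact: nbhs_infty_ger.
have sn : rt n <= n%:R.
  have s1 := sqrt_nat_ge1 n0.
  by rewrite -[in leRHS]sqrt_nat_sqr expr2 ler_peMl // (le_trans _ s1).
have /andP[u1 u2] := u_bounds n0.
rewrite ler_norml in h; case/andP: h => h1 h2.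
have /andP[t1 t2] := truncn_itv (mulr_ge0 (ltW a0) ts0); rewrite -/t -?(natr1 t) in t1 t2.
have gap : (a - 1) / 2 * n%:R <= t%:R - u n.
  have : a * (u n - C * rt n) <= a * ts n 2^-1 by rewrite ler_wpM2l ?(ltW a0) //; lra.
  have : (a - 1) * n%:R <= (a - 1) * u n by rewrite ler_wpM2l // ltW.
  by lra.
have N0 : 0 < n%:R :> R by rewrite ltr0n.
have gap0 : 0 <= (a - 1) / 2 * n%:R by rewrite mulr_ge0 // divr_ge0 // ltW.
have tu : u n <= t%:R by lra.
have hD := D_upper n0 tu.
have tA : t%:R <= a * (2 + C) * n%:R.
  apply: (le_trans t1); rewrite -mulrA ler_wpM2l ?(ltW a0) //.
  have : C * rt n <= C * n%:R by rewrite ler_wpM2l // ltW.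
  by lra.
have : D n t * ((a - 1) / 2 * n%:R) ^+ 2 <= a * (2 + C) * n%:R.
  apply: (@le_trans _ _ (D n t * (t%:R - u n) ^+ 2)); last exact: le_trans hD tA.
  rewrite ler_wpM2l // lerXn2r ?nnegrE //; lra.
have -> : a * (2 + C) * n%:R = A / n%:R * ((a - 1) / 2 * n%:R) ^+ 2 :> R.
  by rewrite /A; field; rewrite !gt_eqF.
by rewrite ler_pM2r // exprn_gt0 // mulr_gt0 // divr_gt0.
Unshelve. all: by end_near. Qed.

End CutoffFromConcentration.

(** * Concentration for the ARW chain, and conclusion *)

Lemma separation_concentration (R : realType) (V : finType) (K : V -> V -> R)
    (lambda q : R) : killed_kernel K -> 0 < lambda -> (0 < #|V|)%N ->
  (forall w, loss K (~: [set w]%SET) = q) -> q <= 2^-1 ->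
  let D := d_sep (ARW K lambda (uniform_law R V)) in
  exists u : R, [/\ #|V|%:R <= u <= 2 * #|V|%:R, forall t, 0 <= D t <= 1,
    forall t : nat, u <= t%:R -> D t * (t%:R - u) ^+ 2 <= t%:R,
    forall t : nat, t%:R <= u -> (1 - D t) * (u - t%:R) ^+ 2 <= t%:R
    & forall t : nat, (#|V| <= t)%N ->
      (u - t%:R) * (t%:R - #|V|%:R) ^+ 2 <= 8 * #|V|%:R * t%:R].
Proof.
move=> Kk lambda0 V0 lossq q2 D.
have DE t : D t = 1 - filled K t by rewrite /D (d_sepE Kk lambda0 V0 lossq q2).
have [u [u_full u_drift]] := exists_filling_time Kk lossq q2.
have card0 : #|~: (finset.set0 : {set V})| = #|V| by rewrite finset.setC0 finset.cardsT.
exists (u finset.set0); split=> [|t|t ut|t tu|t nt].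
- rewrite -card0 (card_le_filling_time Kk V0 lossq q2 u_full u_drift).
  exact: (filling_time_le Kk V0 lossq q2 u_full u_drift).
- rewrite DE subr_ge0 (filled_le1 Kk V0) gerBl -(iter_idla_cst Kk V0 t 0 finset.set0).
  by apply: le_iter_idla => // A; exact: ler0n.
- by rewrite DE; exact: (filling_upper_tail Kk V0 lossq q2 u_full u_drift).
- by rewrite DE subKr; exact: (filling_lower_tail Kk V0 lossq q2 u_full u_drift).
- exact: (filling_time_bound Kk V0 lossq q2 u_full u_drift).
Qed.

Theorem corollary2 (R : realType) (T : nat -> finType)
    (e : forall n, rel (T n)) (o : forall n, T n) (lambda : nat -> R)
    (simple_e : forall n, (0 < n)%N -> simple_graph (e n))
    (card_T : forall n, (0 < n)%N -> #|T n| = n.+1)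
    (connected_e : forall n, (0 < n)%N -> connected_graph (e n))
    (transitive_e : forall n, (0 < n)%N -> vertex_transitive (e n))
    (lambda_gt0 : forall n, (0 < n)%N -> 0 < lambda n) :
  let P n := ARW (killed_walk R (e n) (o n)) (lambda n)
               (uniform_law R (punctured (o n))) in
  [/\ forall n, (0 < n)%N -> t_rel (P n) = 2 * n%:R / n.+1%:R,
      (fun n => t_sep (P n) - n%:R) =o_\oo (fun n => n%:R : R)
    & separation_cutoff_window P (fun n => Num.sqrt (n%:R : R))].
Proof.
move=> P; pose q n : R := (n%:R - 1) / (2 * n%:R).
have Kk n n0 := killed_walk_kernel R (o n) (connected_e n n0) n0 (card_T n n0).
have card_V n n0 := card_punctured (o n) (card_T n n0).
have V0 n : (0 < n)%N -> (0 < #|punctured (o n)|)%N by move=> n0; rewrite card_V.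
have lossq n (n0 : (0 < n)%N) w : loss (killed_walk R (e n) (o n)) (~: [set w]%SET) = q n.
  exact: (loss_killed_walk R (simple_e n n0) (connected_e n n0) (transitive_e n n0) n0 (card_T n n0) w).
have q2 n : (0 < n)%N -> q n <= 2^-1.
  move=> n0; have N0 : 0 < n%:R :> R by rewrite ltr0n.
  by rewrite /q ler_pdivrMr ?mulr_gt0 //; lra.
have /choice[u uP] : forall n, exists u : R, (0 < n)%N ->
  [/\ n%:R <= u <= 2 * n%:R, forall t, 0 <= d_sep (P n) t <= 1,
    forall t : nat, u <= t%:R -> d_sep (P n) t * (t%:R - u) ^+ 2 <= t%:R,
    forall t : nat, t%:R <= u -> (1 - d_sep (P n) t) * (u - t%:R) ^+ 2 <= t%:R
    & forall t : nat, (n <= t)%N -> (u - t%:R) * (t%:R - n%:R) ^+ 2 <= 8 * n%:R * t%:R].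
  (* At index 0 the required property is vacuous and 0 is a placeholder. *)
  move=> n; have [->|n0] := posnP n; first by exists 0.
  have [u] := separation_concentration (Kk n n0) (lambda_gt0 n n0) (V0 n n0) (lossq n n0) (q2 n n0).
  by rewrite card_V // => H; exists u.
have H1 n (n0 : (0 < n)%N) : n%:R <= u n <= 2 * n%:R by case: (uP n n0).
have H2 n t (n0 : (0 < n)%N) : 0 <= d_sep (P n) t <= 1 by case: (uP n n0).
have H3 n t (n0 : (0 < n)%N) : u n <= t%:R -> d_sep (P n) t * (t%:R - u n) ^+ 2 <= t%:R.
  by case: (uP n n0) => _ _ + _ _; apply.
have H4 n t (n0 : (0 < n)%N) : t%:R <= u n -> (1 - d_sep (P n) t) * (u n - t%:R) ^+ 2 <= t%:R.
  by case: (uP n n0) => _ _ _ + _; apply.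
have H5 n t (n0 : (0 < n)%N) : (n <= t)%N ->
    (u n - t%:R) * (t%:R - n%:R) ^+ 2 <= 8 * n%:R * t%:R.
  by case: (uP n n0) => _ _ _ _; apply.
split=> [n n0||].
- rewrite (t_relE (Kk n n0) (lambda_gt0 n n0) (V0 n n0) (lossq n n0) (q2 n n0)) /q -natr1.
  have N0 : 0 < n%:R :> R by rewrite ltr0n.
  by field; rewrite !gt_eqF //; lra.
- exact: sep_time_equivalent H1 H2 H3 H4 H5.
split; last by move=> eps; exact: sep_time_window H1 H2 H3 H4 eps.
move=> alpha alpha0; split=> alpha1; first exact: sep_cutoff_before H1 H2 H3 H4 _ _ _.
exact: sep_cutoff_after H1 H2 H3 H4 _ _.
Qed.
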